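(* Let $\mathcal{X}$ be a smooth manifold with a closed reflexive relation $\le$. Let $Q$ be a tree with vertices indexed by $X=\{1,2,\dots,|X|\}$, $|X|\ge2$, with two-point distributions $t_\ell, w_{\ell\pm}$ attached to its lines $\ell$ as in the context, and let $\mathcal{S}$ be a cell relative to $X$, with opposite cell $\mathcal{S}'$. For each line $\ell$ of $Q$, with ends $b(\ell)<e(\ell)$, let $B(\ell)$ and $E(\ell)$ be the sets of vertices of the two subtrees of $Q$ obtained by severing the line $\ell$, with $b(\ell)\in B(\ell)$ and $e(\ell)\in E(\ell)$. Then the generalized retarded function $r_{\mathcal{S}}$ associated to $Q$ is a product over the lines of $Q$ of two-point generalized retarded functions, $$r_{\mathcal{S}}=\prod_{\ell} r_{b(\ell)\updownarrow e(\ell)},$$ where each factor is either $r_{b(\ell)\uparrow e(\ell)}$ or $r_{b(\ell)\downarrow e(\ell)}$, determined as follows. (i) If $e(\ell)$ is an extremity of the tree $Q$ (i.e. if $E(\ell)=\{e(\ell)\}$), the factor contributed by the line $\ell$ is $r_{e(\ell)\uparrow b(\ell)}$ if $\{e(\ell)\}\in\mathcal{S}$, and it is $r_{e(\ell)\downarrow b(\ell)}$ if $\{e(\ell)\}\in\mathcal{S}'$. (ii) More generally, the factor contributed by the line $\ell$ is $r_{b(\ell)\uparrow e(\ell)}$ if $B(\ell)\in\mathcal{S}$, and $r_{b(\ell)\downarrow e(\ell)}$ if $B(\ell)\in\mathcal{S}'$.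
   Context: Sets and cells. For a finite set $W$ with $|W|\ge2$, $\mathcal{P}_*(W)$ is the set of subsets of $W$ different from $\emptyset$ and $W$. A proper sequence in $\mathcal{P}(W)$ is a finite (ordered) sequence $\{J_1,\dots,J_\nu\}$ of non-empty, pairwise disjoint subsets of $W$ with union $W$. A paracell relative to $W$ is a non-empty $\mathcal{S}\subset\mathcal{P}_*(W)$ such that $I,J\in\mathcal{S}$ implies $I\cap J\in\mathcal{S}$ or $I\cup J\in\mathcal{S}$; its opposite is $\mathcal{S}'=\{J\subset W: W\setminus J\in\mathcal{S}\}$. A precell is a paracell with $\mathcal{S}\cup\mathcal{S}'=\mathcal{P}_*(W)$. A cell is a precell $\mathcal{S}$ for which there exist real numbers $(s_j)_{j\in W}$ with $\sum_{j\in W}s_j=0$ and $\sum_{j\in J}s_j>0$ for all $J\in\mathcal{S}$; then $\mathcal{S}'$ is also a cell. Trees. A tree $Q$ is a connected and simply connected (acyclic) graph with vertex set $X$; each line (edge) $\ell$ has two distinct ends $b(\ell)<e(\ell)$ in $X$. An extremity of $Q$ is a vertex which is an end of a single line. Two-point functions. A distribution $F$ on a power of $\mathcal{X}$ has property PR (partial regularity) if for every one of its variables it is $C^\infty$ in that variable when smeared with smooth test functions in the remaining variables. To each line $\ell$ are attached distributions $t_\ell$, $w_{\ell+}$, $w_{\ell-}$ on $\mathcal{X}^2$ with property PR: $t_\ell(u,v)=t_\ell(v,u)$ is the time-ordered two-point function, and $w_{\ell+}(u,v)=w_{\ell-}(v,u)$ the vacuum expectation value of the product $\phi_\ell(u)\phi_\ell(v)$,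 of a free or generalized free field $\phi_\ell$. In terms of these distributions the two-point generalized retarded functions are $$r_{e(\ell)\uparrow b(\ell)}=r_{b(\ell)\downarrow e(\ell)}=t_\ell(x_{b(\ell)},x_{e(\ell)})-w_{\ell+}(x_{b(\ell)},x_{e(\ell)}),$$ $$r_{e(\ell)\downarrow b(\ell)}=r_{b(\ell)\uparrow e(\ell)}=t_\ell(x_{b(\ell)},x_{e(\ell)})-w_{\ell-}(x_{b(\ell)},x_{e(\ell)}),$$ and it is assumed (causal factorization) that $r_{e(\ell)\uparrow b(\ell)}$ is supported in $\{x_{b(\ell)}\le x_{e(\ell)}\}$ and $r_{e(\ell)\downarrow b(\ell)}$ in $\{x_{e(\ell)}\le x_{b(\ell)}\}$. Generalized time-ordered functions of the tree. For a proper sequence $\{J_1,\dots,J_\nu\}$ in $\mathcal{P}(X)$, $$t_{J_1,\dots,J_\nu}(x_1,\dots,x_{|X|})=\prod_\ell F_\ell(x_{b(\ell)},x_{e(\ell)}),$$ the product being over all lines of $Q$, where $F_\ell=t_\ell$ if $b(\ell)$ and $e(\ell)$ belong to the same $J_k$; $F_\ell=w_{\ell+}$ if $b(\ell)\in J_r$, $e(\ell)\in J_k$ with $r<k$; $F_\ell=w_{\ell-}$ if $b(\ell)\in J_r$, $e(\ell)\in J_k$ with $r>k$. Such products along a tree of two-point distributions with property PR are well defined distributions with property PR: inductively, two factors sharing a single variable $x_k$ are multiplied by smearing in all the other variables, which gives a product of two $C^\infty$ functions of $x_k$, then integrating against a test function of $x_k$ (functions being identified with distributions by a fixed smooth positive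 density on $\mathcal{X}$). The products in the claim are understood in the same sense. Generalized retarded function. For a cell $\mathcal{S}$ relative to $X$ with opposite cell $\mathcal{S}'$, $$r_{\mathcal{S}}=\sum_{\nu=1}^{|X|}(-1)^{\nu-1}\sum_{\{J_1,\dots,J_\nu\}\in\mathcal{M}_\nu(\mathcal{S}')}t_{J_1,\dots,J_\nu},$$ where $\mathcal{M}_\nu(\mathcal{S}')$ is the set of proper sequences $\{J_1,\dots,J_\nu\}$ in $\mathcal{P}(X)$ with $J_1\cup\dots\cup J_r\in\mathcal{S}'$ for every $1\le r<\nu$ (no condition if $\nu=1$). *)

(* Defs.v *)
From HB Require Import structures.
From mathcomp Require Import all_boot all_order all_algebra.
From mathcomp.real_closed Require Import complex.
From mathcomp Require Import all_classical all_reals all_analysis.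
Set Implicit Arguments.
Unset Strict Implicit.
Unset Printing Implicit Defensive.
Import Order.TTheory GRing.Theory Num.Theory.
Import numFieldNormedType.Exports.
Local Open Scope classical_set_scope.
Local Open Scope complex_scope.
Local Open Scope ring_scope.

(** * Cells and proper sequences *)

Definition proper_subsets (W : finType) : {set {set W}} :=
  [set J | (J != finset.set0) && (J != [set: W]%SET)]%SET.

Definition opposite (W : finType) (S : {set {set W}}) : {set {set W}} :=
  [set J | (~: J)%SET \in S]%SET.

Definition paracell (W : finType) (S : {set {set W}}) : Prop :=
  [/\ S != finset.set0, S \subset proper_subsets W &
      forall I J, I \in S -> J \in S ->
        (I :&: J)%SET \in S \/ (I :|: J)%SET \in S].

Definition precell (W : finType) (S : {set {set W}}) : Prop :=
  paracell S /\ (S :|: opposite S)%SET = proper_subsets W.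

Definition cell (R : realType) (W : finType) (S : {set {set W}}) : Prop :=
  precell S /\
  exists s : W -> R, \sum_j s j = 0 /\
    forall J, J \in S -> 0 < \sum_(j in J) s j.

Definition proper_sequence (W : finType) (J : seq {set W}) : bool :=
  [&& all (fun A : {set W} => A != finset.set0) J,
      pairwise (fun A B : {set W} => (A :&: B)%SET == finset.set0) J
    & (\bigcup_(A <- J) A)%SET == [set: W]%SET].

Definition sequences_over (W : finType) (C : {set {set W}}) (nu : nat) :
    {set nu.-tuple {set W}} :=
  [set J : nu.-tuple {set W} | proper_sequence J &&
     [forall r : 'I_nu,
        (0 < r)%N ==> ((\bigcup_(A <- take r J) A)%SET \in C)]]%SET.

(** The position of the first term of [J] that contains [v]; for a proper
    sequence this is the only such term. *)
Definition block (W : finType) (J : seq {set W}) (v : W) : nat :=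
  find (fun A : {set W} => v \in A) J.

(** * Trees *)

Definition tree (n : nat) (Q : rel 'I_n) : Prop :=
  [/\ symmetric Q, irreflexive Q,
      forall u v, connect Q u v
    & forall p : seq 'I_n, ucycle Q p -> (size p <= 2)%N].

Definition line (n : nat) (Q : rel 'I_n) : Type :=
  {l : 'I_n * 'I_n | (l.1 < l.2)%N && Q l.1 l.2}.

Definition bend (n : nat) (Q : rel 'I_n) (l : line Q) : 'I_n := (val l).1.
Definition eend (n : nat) (Q : rel 'I_n) (l : line Q) : 'I_n := (val l).2.

Definition extremity (n : nat) (Q : rel 'I_n) (v : 'I_n) : Prop :=
  exists! l : line Q, v = bend l \/ v = eend l.

Definition sever (n : nat) (Q : rel 'I_n) (l : line Q) : rel 'I_n :=
  [rel u v | [&& Q u v, (u, v) != (bend l, eend l)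
                      & (u, v) != (eend l, bend l)]].

Definition Bside (n : nat) (Q : rel 'I_n) (l : line Q) : {set 'I_n} :=
  [set v | connect (sever l) (bend l) v]%SET.

(** * Smooth manifolds, their powers, and test functions *)

(** Raw charts with values in ['M[R]_(m, d)], i.e. in R^(m * d). A manifold
    uses m = 1; its n-th power, whose points are the row vectors ['rV[M]_n]
    (with the product topology), uses m = n. *)
Record chart (R : realType) (T : Type) (m d : nat) := Chart {
  cdom : set T;
  cimg : set 'M[R]_(m, d);
  cmap : T -> 'M[R]_(m, d);
  cinv : 'M[R]_(m, d) -> T
}.

Definition chart_homeomorphism (R : realType) (T : topologicalType) (m d : nat)
    (c : chart R T m d) : Prop :=
  [/\ open (cdom c) /\ open (cimg c),
      (forall x, cdom c x -> cimg c (cmap c x) /\ cinv c (cmap c x) = x),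
      (forall y, cimg c y -> cdom c (cinv c y) /\ cmap c (cinv c y) = y),
      (forall x, cdom c x -> {for x, continuous (cmap c)})
    & (forall y, cimg c y -> {for y, continuous (cinv c)})].

Definition partial (R : realType) (m d : nat) (s : seq ('I_m * 'I_d))
    (g : 'M[R]_(m, d) -> R) : 'M[R]_(m, d) -> R :=
  foldr (fun ij h => 'D_(delta_mx ij.1 ij.2) h) g s.

Definition smooth_on (R : realType) (m d : nat) (U : set 'M[R]_(m, d))
    (g : 'M[R]_(m, d) -> R) : Prop :=
  forall (s : seq ('I_m * 'I_d)) y, U y ->
    {for y, continuous (partial s g)} /\
    forall i j, derivable (partial s g) y (delta_mx i j).

Record manifold (R : realType) (d : nat) := Manifold {
  carrier :> topologicalType;
  atlas : set (chart R carrier 1 d);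
  manifold_hausdorff : hausdorff_space carrier;
  manifold_countable : @second_countable carrier;
  manifold_charts : forall c, atlas c -> chart_homeomorphism c;
  manifold_cover : forall x, exists2 c, atlas c & cdom c x;
  manifold_compatible : forall c c' j, atlas c -> atlas c' ->
    smooth_on (cimg c `&` cinv c @^-1` cdom c')
              (fun y => cmap c' (cinv c y) ord0 j)
}.

Definition power_chart (R : realType) (T : Type) (n d : nat)
    (c : 'I_n -> chart R T 1 d) : chart R 'rV[T]_n n d :=
  Chart [set x : 'rV[T]_n | forall i, cdom (c i) (x ord0 i)]
        [set y | forall i, cimg (c i) (row i y)]
        (fun x : 'rV[T]_n => \matrix_(i, j) cmap (c i) (x ord0 i) ord0 j)
        (fun y => \row_i cinv (c i) (row i y)).

Definition power_atlas (R : realType) (d : nat) (M : manifold R d) (n : nat) :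
    set (chart R 'rV[M]_n n d) :=
  [set power_chart c | c in [set c | forall i, @atlas R d M (c i)]].

Definition smooth (R : realType) (T : Type) (m d : nat)
    (A : set (chart R T m d)) (f : T -> R[i]) : Prop :=
  forall c, A c ->
    smooth_on (cimg c) (fun y => complex.Re (f (cinv c y))) /\
    smooth_on (cimg c) (fun y => complex.Im (f (cinv c y))).

Definition supp (R : realType) (T : topologicalType) (f : T -> R[i]) : set T :=
  closure [set x | f x != 0].

Definition test (R : realType) (T : topologicalType) (m d : nat)
    (A : set (chart R T m d)) (f : T -> R[i]) : Prop :=
  smooth A f /\ compact (supp f).

(** * Distributions *)

(** Functionals are total, but only their values on test functions are
    meaningful. *)
Definition functional (R : realType) (T : Type) : Type := (T -> R[i]) -> R[i].

Definition linear_on_tests (R : realType) (T : topologicalType) (m d : nat)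
    (A : set (chart R T m d)) (F : functional R T) : Prop :=
  forall (a : R[i]) f g, test A f -> test A g ->
    F (fun x => a * f x + g x) = a * F f + F g.

(** Convergence to 0 in the space of test functions: supports in a fixed
    compact set, and uniform convergence on compact sets of all the
    derivatives in the charts. *)
Definition null_sequence (R : realType) (T : topologicalType) (m d : nat)
    (A : set (chart R T m d)) (u : nat -> T -> R[i]) : Prop :=
  [/\ forall k, test A (u k),
      (exists2 K : set T, compact K & forall k, supp (u k) `<=` K)
    & forall c (L : set 'M[R]_(m, d)) (s : seq ('I_m * 'I_d)) (e : R),
        A c -> compact L -> L `<=` cimg c -> 0 < e ->
        \forall k \near \oo, forall y, L y ->
          `|(partial s (fun z => complex.Re (u k (cinv c z))) y : R)| <= e /\
          `|(partial s (fun z => complex.Im (u k (cinv c z))) y : R)| <= e].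

Definition distribution (R : realType) (T : topologicalType) (m d : nat)
    (A : set (chart R T m d)) (F : functional R T) : Prop :=
  linear_on_tests A F /\
  forall u, null_sequence A u ->
    (fun k => complex.Re (F (u k))) @ \oo --> (0 : R) /\
    (fun k => complex.Im (F (u k))) @ \oo --> (0 : R).

Definition dsupp (R : realType) (T : topologicalType) (m d : nat)
    (A : set (chart R T m d)) (F : functional R T) : set T :=
  [set x | forall U : set T, open U -> U x ->
     exists f, [/\ test A f, supp f `<=` U & F f != 0]].

(** Iterated Lebesgue integral over R^d. *)
Fixpoint iter_integral (R : realType) (d : nat) : ('rV[R]_d -> R) -> R :=
  match d with
  | 0 => fun f => f 0
  | d'.+1 => fun f =>
      Rintegral (@lebesgue_measure R) setT (fun x : R =>
        iter_integral (fun y : 'rV[R]_d' => f (row_mx (x%:M : 'M[R]_1) y)))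
  end.

(** A smooth positive density, given by the integral of test functions that
    it defines; partitions of unity reduce this integral to the case of test
    functions supported in the domain of a chart. *)
Record density (R : realType) (d : nat) (M : manifold R d) := Density {
  dint : functional R M;
  dint_linear : linear_on_tests (@atlas R d M) dint;
  dint_local : forall c, atlas c -> exists rho : 'rV[R]_d -> R,
    [/\ smooth_on (cimg c) rho,
        forall y, cimg c y -> 0 < rho y
      & forall f, test (@atlas R d M) f -> supp f `<=` cdom c ->
          dint f =
            iter_integral
              ((fun y => complex.Re (f (cinv c y)) * rho y) \_ (cimg c)) +i*
            iter_integral
              ((fun y => complex.Im (f (cinv c y)) * rho y) \_ (cimg c))]
}.

(** [phi] is the smooth function of the [i]-th variable obtained by smearing
    [F] with [g] in the remaining variables. *)
Definition smeared (R : realType) (d : nat) (M : manifold R d)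
    (mu : density M) (n : nat) (F : functional R 'rV[M]_n) (i : 'I_n)
    (g : 'rV[M]_n.-1 -> R[i]) (phi : M -> R[i]) : Prop :=
  smooth (@atlas R d M) phi /\
  forall h, test (@atlas R d M) h ->
    F (fun x => h (x ord0 i) * g (col' i x)) = dint mu (fun u => h u * phi u).

Definition partially_regular (R : realType) (d : nat) (M : manifold R d)
    (mu : density M) (n : nat) (F : functional R 'rV[M]_n) : Prop :=
  forall i g, test (power_atlas (M := M) (n := n.-1)) g ->
    exists phi, smeared mu F i g phi.

(** * Two-point functions *)

(** The two variables of a two-point distribution attached to a line [l] are,
    in this order, the variables of [bend l] and [eend l]. *)
Definition two_point (R : realType) (d : nat) (M : manifold R d) : Type :=
  functional R 'rV[M]_2.

Definition swap (T : Type) (x : 'rV[T]_2) : 'rV[T]_2 :=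
  \row_i x ord0 (rev_ord i).

(** Retarded functions of a line, from its [t], [w+] and [w-]. The suffix
    [eUb] reads e(l) up b(l), the suffix [eDb] reads e(l) down b(l), etc. *)
Definition r_eUb (R : realType) (d : nat) (M : manifold R d)
  (t wp wm : two_point M) : two_point M := fun f => t f - wp f.
Definition r_eDb (R : realType) (d : nat) (M : manifold R d)
  (t wp wm : two_point M) : two_point M := fun f => t f - wm f.
Definition r_bUe (R : realType) (d : nat) (M : manifold R d)
  (t wp wm : two_point M) : two_point M := r_eDb t wp wm.
Definition r_bDe (R : realType) (d : nat) (M : manifold R d)
  (t wp wm : two_point M) : two_point M := r_eUb t wp wm.

Definition line_functions (R : realType) (d : nat) (M : manifold R d)
    (mu : density M) (le : M -> M -> Prop) (t wp wm : two_point M) : Prop :=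
  let A := power_atlas (M := M) (n := 2) in
  [/\ (distribution A t /\ partially_regular mu t) /\
      (distribution A wp /\ partially_regular mu wp) /\
      (distribution A wm /\ partially_regular mu wm),
      (forall f, test A f -> t (f \o @swap M) = t f),
      (forall f, test A f -> wm (f \o @swap M) = wp f),
      dsupp A (r_eUb t wp wm)
        `<=` [set x | le (x ord0 ord0) (x ord0 ord_max)]
    & dsupp A (r_eDb t wp wm)
        `<=` [set x | le (x ord0 ord_max) (x ord0 ord0)]].

(** * Products along a tree *)

Definition lend (n : nat) (Q : rel 'I_n) (l : line Q) (i : 'I_2) : 'I_n :=
  if i == ord0 then bend l else eend l.

(** [tree_value mu F V f z]: [z] is the value on the tensor product of the
    test functions [f v], v in V, of the product over the lines of the
    subtree with vertex set V of the [F l]. The product over this subtree is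
    the product of the factor [F l] of a terminal line [l] and of the product
    over the subtree without the extremity [k] of [l]; these two factors
    share the single variable [p]. Smearing them in all their other variables
    gives a smooth function [phi] for [F l] and one, [psi] say, for the
    other, so that the value is the integral of [f p * phi * psi], which is
    the other factor evaluated with [f p * phi] instead of [f p]. *)
Inductive tree_value (R : realType) (d : nat) (M : manifold R d)
    (mu : density M) (n : nat) (Q : rel 'I_n) (F : line Q -> two_point M) :
    {set 'I_n} -> ('I_n -> M -> R[i]) -> R[i] -> Prop :=
| TreeVertex k f : tree_value mu F [set k]%SET f (dint mu (f k))
| TreeLeaf (V : {set 'I_n}) (l : line Q) (i j : 'I_2) f phi z :
    let p := lend l i in
    let k := lend l j in
    i != j -> p \in V -> k \in V ->
    (forall v, v \in V -> Q k v -> v = p) ->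
    smeared mu (F l) i (fun y => f k (y ord0 ord0)) phi ->
    tree_value mu F (V :\ k)%SET
      (fun v u => if v == p then f v u * phi u else f v u) z ->
    tree_value mu F V f z.

Definition tensor (R : realType) (T : Type) (n : nat) (f : 'I_n -> T -> R[i]) :
    'rV[T]_n -> R[i] :=
  fun x => \prod_(v < n) f v (x ord0 v).

(** [P] is the product of the [F l] over the lines of the tree [Q]. *)
Definition tree_product (R : realType) (d : nat) (M : manifold R d)
    (mu : density M) (n : nat) (Q : rel 'I_n) (F : line Q -> two_point M)
    (P : functional R 'rV[M]_n) : Prop :=
  [/\ distribution (power_atlas (M := M) (n := n)) P,
      partially_regular mu P
    & forall f, (forall v, test (@atlas R d M) (f v)) ->
        forall z, tree_value mu F [set: 'I_n]%SET f z <-> z = P (tensor f)].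

(** * Generalized time-ordered and retarded functions *)

Definition ordered_factor (R : realType) (d : nat) (M : manifold R d)
    (n : nat) (Q : rel 'I_n) (t wp wm : line Q -> two_point M)
    (J : seq {set 'I_n}) (l : line Q) : two_point M :=
  if block J (bend l) == block J (eend l) then t l
  else if (block J (bend l) < block J (eend l))%N then wp l
  else wm l.

Definition retarded (R : realType) (T : Type) (n : nat) (S : {set {set 'I_n}})
    (tJ : seq {set 'I_n} -> functional R T) : functional R T :=
  fun f => \sum_(1 <= nu < n.+1) (-1) ^+ nu.-1 *
    \sum_(J in sequences_over (opposite S) nu) tJ J f.

(* Main.v *)
(** Fix an order in which the tree is pruned, one extremity at a time. It
    expresses the product over the lines as a multilinear function of the
    two-point factors, so the theorem becomes an identity between formal
    products, proved by induction on the pruning.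

    Let [k] be the extremity removed first and [p] the vertex carrying it, and
    let the numbers [s_j] define the cell. For a fixed ordered partition of the
    other vertices, sum over the ways to insert [k], either in an existing block
    or as a new block. If [s_k < 0] (resp. [s_k > 0]), the terms with [k] after
    (resp. before) [p] cancel, and those on the other side telescope: what
    remains is [t] minus the factor for [k] before (resp. after) [p], multiplied
    by the indicator of the partitions admissible for the cell in which [k] has
    been merged with [p], that is for [s'_p = s_p + s_k]. The merged weight of a
    vertex that is about to be removed is the sum of the [s_j] over the side of
    its line that contains it, which is how the sets [B(l)] enter. *)

Require Import Defs.
From mathcomp Require Import all_boot all_order all_algebra.
From mathcomp.real_closed Require Import complex.
From mathcomp Require Import zify ring.
From mathcomp Require Import all_classical all_reals all_analysis.
Import Order.TTheory GRing.Theory Num.Theory.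
Import numFieldNormedType.Exports.
Local Open Scope classical_set_scope.
Local Open Scope ring_scope.
Set Implicit Arguments.
Unset Strict Implicit.
Unset Printing Implicit Defensive.

(** * Smooth functions on open sets of coordinate space *)

Lemma derivable_mulD (R : realType) (V : normedModType R) (f g h : V -> R)
    (x v : V) : derivable f x v -> derivable g x v -> derivable h x v ->
  derivable (f * g + h) x v.
Proof. move=> df dg dh; exact: (derivableD (derivableM df dg) dh). Qed.

Lemma derive_mulD (R : realType) (V : normedModType R) (f g h : V -> R)
    (x v : V) : derivable f x v -> derivable g x v -> derivable h x v ->
  'D_v (f * g + h) x = f x * 'D_v g x + (g x * 'D_v f x + 'D_v h x).
Proof.
move=> df dg dh.
by rewrite (deriveD (derivableM df dg) dh) (deriveM df dg) -addrA.
Qed.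

Lemma continuous_mulD (R : realType) (V : normedModType R) (f g h : V -> R)
    (x : V) : {for x, continuous f} -> {for x, continuous g} ->
  {for x, continuous h} -> {for x, continuous (f * g + h)}.
Proof.
move=> cf cg ch; exact: (continuousD (continuousM cf cg) ch).
Qed.

Section Smooth.
Variables (R : realType) (m d : nat).
Implicit Types (U : set 'M[R]_(m, d)) (g h : 'M[R]_(m, d) -> R).

Lemma partial_rcons (s : seq ('I_m * 'I_d)) (ij : 'I_m * 'I_d) g :
  partial (rcons s ij) g = partial s ('D_(delta_mx ij.1 ij.2) g).
Proof. by rewrite /partial -cats1 foldr_cat. Qed.

Lemma smooth_on_derive U g (i : 'I_m) (j : 'I_d) :
  smooth_on U g -> smooth_on U ('D_(delta_mx i j) g).
Proof. by move=> sg s y Uy; rewrite -(partial_rcons s (i, j)); exact: sg. Qed.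

Lemma smooth_on_cst U (a : R) : smooth_on U (cst a).
Proof.
move=> s y Uy.
have [b ->] : exists b, partial s (cst a) = cst b.
  elim: s => [|[i j] s [b IH]] /=; first by exists a.
  exists 0; rewrite /= IH; apply/funext => z; exact: derive_cst.
split; first exact: cst_continuous.
by move=> i j; exact: derivable_cst.
Qed.

(** By the Leibniz rule, finite sums of products of smooth functions are stable under partial
    derivatives, so one induction handles all derivatives of a product. *)
Definition sum_prod (L : seq (('M[R]_(m, d) -> R) * ('M[R]_(m, d) -> R)))
    : 'M[R]_(m, d) -> R :=
  foldr (fun p F => p.1 * p.2 + F) (cst 0) L.

Definition smooth_pairs U (L : seq (('M[R]_(m, d) -> R) * ('M[R]_(m, d) -> R)))
    : Prop :=
  foldr (fun p P => [/\ smooth_on U p.1, smooth_on U p.2 & P]) True L.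

Lemma sum_prod_derivable U L (y v : 'M[R]_(m, d)) :
  smooth_pairs U L -> U y -> (exists i j, v = delta_mx i j) ->
  derivable (sum_prod L) y v.
Proof.
move=> sL Uy [i [j ->]]; elim: L sL => [_|[g h] L IH /= [sg sh /IH sL]].
  exact: derivable_cst.
exact: (derivable_mulD ((sg [::] y Uy).2 i j) ((sh [::] y Uy).2 i j)).
Qed.

Lemma sum_prod_continuous U L (y : 'M[R]_(m, d)) :
  smooth_pairs U L -> U y -> {for y, continuous (sum_prod L)}.
Proof.
move=> sL Uy; elim: L sL => [_|[g h] L IH /= [sg sh /IH sL]].
  exact: cst_continuous.
exact: (continuous_mulD (sg [::] y Uy).1 (sh [::] y Uy).1).
Qed.

Lemma sum_prod_derive U L (i : 'I_m) (j : 'I_d) : smooth_pairs U L ->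
  exists2 L', smooth_pairs U L' &
    forall y, U y -> 'D_(delta_mx i j) (sum_prod L) y = sum_prod L' y.
Proof.
elim: L => [_|[g h] L IH /= [sg sh sL]].
  by exists [::] => // y Uy /=; rewrite derive_cst.
have [L' sL' DL] := IH sL.
exists [:: (g, 'D_(delta_mx i j) h), (h, 'D_(delta_mx i j) g) & L'].
  exact: (And3 sg (smooth_on_derive i j sh)
            (And3 sh (smooth_on_derive i j sg) sL')).
move=> y Uy; rewrite [RHS](_ : _ = g y * 'D_(delta_mx i j) h y +
  (h y * 'D_(delta_mx i j) g y + sum_prod L' y)) // -(DL y Uy).
apply: (derive_mulD ((sg [::] y Uy).2 i j) ((sh [::] y Uy).2 i j)).
by apply: (sum_prod_derivable sL Uy); exists i, j.
Qed.

Lemma open_near_eq U g h (y : 'M[R]_(m, d)) : open U -> U y ->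
  (forall z, U z -> g z = h z) -> \forall z \near y, g z = h z.
Proof.
move=> oU Uy gh.
have : nbhs y U by apply: open_nbhs_nbhs.
exact: filterS.
Qed.

(** Each iterated derivative of [F] agrees on [U] with some [sum_prod]; as [U] is open, this is
    agreement near every point of [U], which transfers continuity and derivability. *)
Lemma smooth_on_sum_prod U L F : open U -> smooth_pairs U L ->
  (forall y, U y -> F y = sum_prod L y) -> smooth_on U F.
Proof.
move=> oU sL FL s.
have {sL FL} [L' sL' FL'] : exists2 L', smooth_pairs U L' &
    forall y, U y -> partial s F y = sum_prod L' y.
  elim: s => [|[i j] s [L' sL' FL']] /=; first by exists L.
  have [L'' sL'' DL''] := sum_prod_derive i j sL'.
  exists L'' => // y Uy; rewrite -DL'' //.
  by apply: near_eq_derive; exact: (open_near_eq oU).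
move=> y Uy; split.
  have e : \forall z \near y, sum_prod L' z = partial s F z.
    by apply: (open_near_eq oU) => // z Uz; rewrite FL'.
  rewrite /prop_for /continuous_at FL' //.
  have c := sum_prod_continuous sL' Uy.
  move=> B /c.
  exact: (near_eq_cvg e).
move=> i j; apply: (@near_eq_derivable _ _ _ (sum_prod L')).
  by apply: (open_near_eq oU) => // z Uz; rewrite FL'.
by apply: (sum_prod_derivable sL' Uy); exists i, j.
Qed.

End Smooth.

(** * Sums and products of complex-valued smooth functions and test functions *)

Section Tests.
Variables (R : realType) (T : topologicalType) (m d : nat).
Variable A : set (chart R T m d).
Hypothesis A_open : forall c, A c -> open (cimg c).
Implicit Types f g : T -> R[i].

Lemma smoothM f g : smooth A f -> smooth A g -> smooth A (fun x => f x * g x).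
Proof.
move=> sf sg c Ac; have [fr fi] := sf c Ac; have [gr gi] := sg c Ac.
have gNi : smooth_on (cimg c) (fun y => - complex.Im (g (cinv c y))).
  refine (smooth_on_sum_prod (A_open Ac) (L := [:: (_, _)])
    (And3 (@smooth_on_cst _ _ _ _ (-1)) gi I) _).
  by move=> y _; rewrite /= !fctE /= mulN1r addr0.
split.
- refine (smooth_on_sum_prod (A_open Ac) (L := [:: (_, _); (_, _)])
    (And3 fr gr (And3 fi gNi I)) _).
  move=> y _; rewrite /= !fctE /=.
  by case: (f _) => a b; case: (g _) => a' b' /=; rewrite addr0 mulrN.
- refine (smooth_on_sum_prod (A_open Ac) (L := [:: (_, _); (_, _)])
    (And3 fr gi (And3 fi gr I)) _).
  move=> y _; rewrite /= !fctE /=.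
  by case: (f _) => a b; case: (g _) => a' b' /=; rewrite !addr0.
Qed.

Lemma smooth_cst (a : R[i]) : smooth A (fun=> a).
Proof. by move=> c Ac; split; exact: (@smooth_on_cst _ _ _ (cimg c)). Qed.

Lemma smoothD f g : smooth A f -> smooth A g -> smooth A (fun x => f x + g x).
Proof.
move=> sf sg c Ac; have [fr fi] := sf c Ac; have [gr gi] := sg c Ac.
have s1 : smooth_on (cimg c) (cst 1) := @smooth_on_cst _ _ _ _ 1.
split.
- refine (smooth_on_sum_prod (A_open Ac) (L := [:: (_, _); (_, _)])
    (And3 s1 fr (And3 s1 gr I)) _).
  move=> y _; rewrite /= !fctE /=.
  by case: (f _) => a b; case: (g _) => a' b' /=; rewrite !mul1r addr0.
- refine (smooth_on_sum_prod (A_open Ac) (L := [:: (_, _); (_, _)])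
    (And3 s1 fi (And3 s1 gi I)) _).
  move=> y _; rewrite /= !fctE /=.
  by case: (f _) => a b; case: (g _) => a' b' /=; rewrite !mul1r addr0.
Qed.

Lemma testM f g : test A f -> smooth A g -> test A (fun x => f x * g x).
Proof.
move=> [sf cf] sg; split; first exact: smoothM.
apply: subclosed_compact cf _; first exact: closed_closure.
apply: closureS => x /=; apply: contra_neq => ->; exact: mul0r.
Qed.

Lemma test0 : test A (fun=> 0).
Proof.
split; first exact: smooth_cst.
rewrite /supp (_ : [set _ | _] = set0) ?closure0; first exact: compact0.
by apply/seteqP; split => x //=; rewrite eqxx.
Qed.

End Tests.

(** * Integration and smearing in one variable *)

Section OneVariable.
Variables (R : realType) (d : nat) (M : manifold R d) (mu : density M).
Local Notation A := (@atlas R d M).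

Lemma atlas_open c : A c -> open (cimg c).
Proof. by move=> /manifold_charts [[]]. Qed.

(** The function that smears a two-point distribution in its other variable lives on rows of length
    one. Its support lies in the image of [supp f] under the continuous map [J], hence is
    compact. *)
Lemma test_row (f : M -> R[i]) : test A f ->
  test (power_atlas (M := M) (n := 1)) (fun y => f (y ord0 ord0)).
Proof.
move=> [sf cf]; split.
  move=> _ [c Ac <-] /=.
  have row1 (y : 'M[R]_(1, d)) : row ord0 y = y.
    by apply/matrixP => i j; rewrite mxE (ord1 i).
  have [sr si] := sf _ (Ac ord0).
  split=> s y Uy; have {}Uy : cimg (c ord0) y by rewrite -[y]row1; exact: Uy.
    rewrite (_ : (fun z => _) = fun z => complex.Re (f (cinv (c ord0) z))).
      exact: sr.
    by apply/funext => z; rewrite mxE row1.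
  rewrite (_ : (fun z => _) = fun z => complex.Im (f (cinv (c ord0) z))).
    exact: si.
  by apply/funext => z; rewrite mxE row1.
pose J (x : M) : 'rV[M]_1 := const_mx x.
have cJ : continuous J.
  move=> x B [P Px PB]; have {}Px : nbhs x (P ord0 ord0).
    by have := Px ord0 ord0; rewrite mxE.
  apply: filterS Px => y Py.
  by apply: PB => i j; rewrite !ord1 mxE.
apply: (@subclosed_compact _ _ (J @` supp f)).
- exact: closed_closure.
- by apply: continuous_compact => //; exact: continuous_subspaceT.
- move=> x clx; exists (x ord0 ord0); last first.
    by apply/matrixP => i j; rewrite mxE !ord1.
  move=> U Ux.
  have /clx [y [/= fy Uy]] : nbhs x [set y : 'rV[M]_1 | U (y ord0 ord0)].
    exists (fun i j => U) => [i j|y /(_ ord0 ord0)//].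
    by rewrite !ord1.
  by exists (y ord0 ord0).
Qed.

Lemma dintD (a : R[i]) (f g : M -> R[i]) : test A f -> test A g ->
  dint mu (fun x => a * f x + g x) = a * dint mu f + dint mu g.
Proof. exact: dint_linear. Qed.

Lemma dint0 : dint mu (fun=> 0) = 0.
Proof.
have t0 := @test0 _ _ _ _ A.
have := dintD 1 t0 t0.
rewrite (_ : (fun x => _) = fun=> 0); last by apply/funext => x; rewrite mulr0 addr0.
by rewrite mul1r => /eqP; rewrite -subr_eq subrr => /eqP <-.
Qed.

Lemma partially_regular_row (F : two_point M) (j : 'I_2) (g : M -> R[i]) :
  partially_regular mu F -> test A g ->
  exists phi, smeared mu F j (fun y => g (y ord0 ord0)) phi.
Proof. by move=> regF tg; apply: regF; exact: test_row. Qed.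

(** Both integrals are the value of [F] on the tensor product of [g] and [h]: [phi] comes from
    smearing with [g], and [psi] from smearing with [h]. Thus pairings with [phi] become pairings
    with [g]. *)
Lemma smeared_transpose (F : two_point M) (j : 'I_2) (h : M -> R[i]) :
  partially_regular mu F -> test A h ->
  exists2 psi, smooth A psi & forall g phi, test A g ->
    smeared mu F (rev_ord j) (fun y => g (y ord0 ord0)) phi ->
    dint mu (fun u => h u * phi u) = dint mu (fun u => g u * psi u).
Proof.
move=> regF th; have [psi [spsi psiE]] := partially_regular_row j regF th.
exists psi => // g phi tg [_ phiE]; rewrite -psiE // -phiE //; congr F.
have revE (i : 'I_2) (x : 'rV[M]_2) : (col' i x) ord0 ord0 = x ord0 (rev_ord i).
  rewrite !mxE; congr (x _ _); apply/val_inj.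
  by case: i => [[|[|i]] //=].
apply/funext => x; by rewrite !revE rev_ordK mulrC.
Qed.

End OneVariable.

(** * Evaluation of a product along a tree by pruning *)

Section Evaluation.
Variables (R : realType) (d : nat) (M : manifold R d) (mu : density M).
Variables (n : nat) (Q : rel 'I_n).
Local Notation A := (@atlas R d M).
Implicit Types (F : line Q -> two_point M) (f : 'I_n -> M -> R[i]).

(** A pruning step is a line with the index of the end that is removed, 0 for [bend] and 1 for
    [eend]; the stem is the end that remains. *)
Definition leaf (s : line Q * 'I_2) : 'I_n := lend s.1 s.2.
Definition stem (s : line Q * 'I_2) : 'I_n := lend s.1 (rev_ord s.2).

Lemma neq_rev_ord2 (i j : 'I_2) : i != j -> i = rev_ord j.
Proof.
by case: i j => [[|[|i]] iP] [[|[|j]] jP] //= _; apply/val_inj.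
Qed.

Lemma leaf_stem s : leaf s != stem s.
Proof.
case: s => [l j]; have /andP[b_lt_e _] := valP l.
rewrite /leaf /stem /lend /bend /eend /=.
by case: j => [[|[|j]] //= jP]; rewrite neq_ltn b_lt_e ?orbT.
Qed.

Fixpoint pruning (k0 : 'I_n) (V : {set 'I_n}) (O : seq (line Q * 'I_2)) : Prop :=
  if O is s :: O' then
    [/\ stem s \in V, leaf s \in V, forall v, v \in V -> Q (leaf s) v -> v = stem s
      & pruning k0 (V :\ leaf s)%SET O']
  else V = [set k0]%SET.

(** A choice among the functions that represent the smeared distribution; the default 0 does not
    occur for a partially regular [F] and a test function [g]. *)
Definition smear (F : two_point M) (i : 'I_2) (g : M -> R[i]) : M -> R[i] :=
  if pselect (exists phi, smeared mu F i (fun y => g (y ord0 ord0)) phi) is left e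
  then projT1 (cid e) else fun=> 0.

Lemma smearP (F : two_point M) i g : partially_regular mu F -> test A g ->
  smeared mu F i (fun y => g (y ord0 ord0)) (smear F i g).
Proof.
move=> regF tg; rewrite /smear; case: pselect => [e|[]].
  exact: (projT2 (cid e)).
exact: partially_regular_row.
Qed.

Definition attach f (p : 'I_n) (phi : M -> R[i]) : 'I_n -> M -> R[i] :=
  fun v u => if v == p then f v u * phi u else f v u.

(** The relation [tree_value] turned into a function of the order of removal [O]. *)
Fixpoint pruned_value F (k0 : 'I_n) (O : seq (line Q * 'I_2)) f : R[i] :=
  if O is s :: O' then
    pruned_value F k0 O'
      (attach f (stem s) (smear (F s.1) (rev_ord s.2) (f (leaf s))))
  else dint mu (f k0).

Lemma attach_test f p phi : (forall v, test A (f v)) -> smooth A phi ->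
  forall v, test A (attach f p phi v).
Proof.
move=> tf sphi v; rewrite /attach; case: (v == p); last exact: tf.
exact: (testM (@atlas_open _ _ M) (tf v) sphi).
Qed.

Lemma pruned_value_tree_value F k0 V O f :
  (forall l, partially_regular mu (F l)) -> pruning k0 V O ->
  (forall v, test A (f v)) ->
  tree_value mu F V f (pruned_value F k0 O f).
Proof.
move=> regF; elim: O V f => [|[l j] O IH] V f /= => [->|[pV kV kp prO]] tf.
  exact: TreeVertex.
have sphi := smearP (rev_ord j) (regF l) (tf (lend l j)).
apply: (TreeLeaf (l := l) (i := rev_ord j) (j := j) _ pV kV kp sphi).
  by case: j {pV kV kp prO sphi} => [[|[|j]]].
apply: IH => //; apply: attach_test => //; exact: sphi.1.
Qed.

(* Only the integrals [dint mu (chi * g)] of the test function [g] attached to a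
   vertex matter, so that linearity, and independence of the choice of smeared
   functions, hold without knowing that these integrals determine [g]. *)
Lemma pruned_value_linear F k0 V O (a b : R[i]) f f1 f2 v :
  (forall l, partially_regular mu (F l)) -> pruning k0 V O -> v \in V ->
  (forall w, test A (f w)) -> (forall w, test A (f1 w)) ->
  (forall w, test A (f2 w)) ->
  (forall w, w \in V -> w != v -> f1 w = f w) ->
  (forall w, w \in V -> w != v -> f2 w = f w) ->
  (forall chi, smooth A chi ->
     dint mu (fun u => chi u * f v u) =
     a * dint mu (fun u => chi u * f1 v u) +
     b * dint mu (fun u => chi u * f2 v u)) ->
  pruned_value F k0 O f =
  a * pruned_value F k0 O f1 + b * pruned_value F k0 O f2.
Proof.
move=> regF; elim: O V f f1 f2 v => [|[l j] O IH] V f f1 f2 v /=.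
  move=> -> /set1P -> _ _ _ _ _ /(_ (fun=> 1) (@smooth_cst _ _ _ _ A 1)).
  have mul1 g : (fun u : M => 1 * g u) = g.
    by apply/funext => u; rewrite mul1r.
  by rewrite !mul1.
move=> [pV kV kp prO] vV tf tf1 tf2 f1E f2E lin.
set k := leaf (l, j); set p := stem (l, j).
have kNp : k != p by exact: leaf_stem.
have sm g : test A g -> smeared mu (F l) (rev_ord j) (fun y => g (y ord0 ord0))
    (smear (F l) (rev_ord j) g) by exact: smearP.
have tat g : (forall w, test A (g w)) ->
    forall w, test A (attach g p (smear (F l) (rev_ord j) (g k)) w).
  by move=> tg; apply: attach_test => //; exact: (sm _ (tg k)).1.
(* If the leaf varies, the variation passes to the stem [p] through the smeared functions;
   [smeared_transpose] brings a pairing at [p] back to one at [k], where [lin] applies. *)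
case: (eqVneq v k) => [vk|vNk].
- have pNv : p != v by rewrite vk eq_sym.
  have f1p := f1E _ pV pNv; have f2p := f2E _ pV pNv.
  apply: (IH (V :\ k)%SET _ _ _ p); [by []| |exact: tat|exact: tat|exact: tat| | |].
  + by rewrite in_setD1 pV eq_sym kNp.
  + move=> w; rewrite in_setD1 -vk => /andP[wv wV] wp.
    by rewrite /attach (negbTE wp) f1E.
  + move=> w; rewrite in_setD1 -vk => /andP[wv wV] wp.
    by rewrite /attach (negbTE wp) f2E.
  move=> chi schi; rewrite /attach eqxx f1p f2p.
  have th : test A (fun u => f p u * chi u).
    by apply: testM => //; exact: atlas_open.
  have [psi spsi psiE] := smeared_transpose j (regF l) th.
  have key g : test A g -> dint mu (fun u => chi u *
      (f p u * smear (F l) (rev_ord j) g u)) = dint mu (fun u => psi u * g u).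
    move=> tg; rewrite [LHS](_ : _ = dint mu (fun u => f p u * chi u *
      smear (F l) (rev_ord j) g u)); last first.
      by congr (dint mu _); apply/funext => u; rewrite mulrA (mulrC (chi u)).
    rewrite (psiE g _ tg (sm g tg)).
    by congr (dint mu _); apply/funext => u; rewrite mulrC.
  by rewrite !key // -vk lin.
- have kE g : (forall w, w \in V -> w != v -> g w = f w) -> g k = f k.
    by apply=> //; rewrite eq_sym.
  apply: (IH (V :\ k)%SET _ _ _ v); [by []| |exact: tat|exact: tat|exact: tat| | |].
  + by rewrite in_setD1 vV vNk.
  + move=> w; rewrite in_setD1 => /andP[wk wV] wv.
    by rewrite /attach (kE _ f1E) f1E.
  + move=> w; rewrite in_setD1 => /andP[wk wV] wv.
    by rewrite /attach (kE _ f2E) f2E.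
  move=> chi schi; rewrite /attach (kE _ f1E) (kE _ f2E).
  (* If the stem varies, the smeared function of the leaf is common to the three families and joins
     [chi]. *)
  case: eqP => [vp|_]; last exact: lin.
  have sphi : smooth A (smear (F l) (rev_ord j) (f k)) := (sm _ (tf k)).1.
  have key g : dint mu (fun u => chi u * (g u * smear (F l) (rev_ord j) (f k) u))
      = dint mu (fun u => chi u * smear (F l) (rev_ord j) (f k) u * g u).
    by congr (dint mu _); apply/funext => u; rewrite -mulrA (mulrC (g u)).
  rewrite !key; apply: lin.
  by apply: smoothM => //; exact: atlas_open.
Qed.

Lemma tree_value_pruning F V f z : tree_value mu F V f z ->
  exists k0 O, pruning k0 V O.
Proof.
elim=> [k g|{}V l i j g phi {}z p k ij pV kV kp sphi tv [k0 [ O prO]]].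
  by exists k, [::].
have iE := neq_rev_ord2 ij.
by exists k0, ((l, j) :: O); split=> //; rewrite /stem /= -iE.
Qed.

(** A derivation of [tree_value] records a pruning but may use any smeared functions; replacing them
    by the chosen ones changes no integral against a test function, hence not the value. *)
Lemma tree_value_pruned_value F V f z :
  (forall l, partially_regular mu (F l)) -> (forall v, test A (f v)) ->
  tree_value mu F V f z ->
  exists k0 O, pruning k0 V O /\ z = pruned_value F k0 O f.
Proof.
move=> regF tf tv.
elim: tv tf => [k g|{}V l i j g phi {}z p k ij pV kV kp sphi tv IH] tg.
  by exists k, [::].
have iE := neq_rev_ord2 ij.
have [k0 [ O [prO ->]]] := IH (attach_test p tg sphi.1).
exists k0, ((l, j) :: O); split=> /=.
  by split=> //; rewrite /stem /= -iE.
have kNp : k != p by rewrite /k /p iE; exact: (leaf_stem (l, j)).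
have sphi' := smearP (rev_ord j) (regF l) (tg k).
(* Linearity with coefficients 1 and 0 serves as a congruence: only integrals of the function at [p]
   get compared. *)
rewrite [LHS](_ : _ = 1 * pruned_value F k0 O (attach g p phi)
                   + 0 * pruned_value F k0 O (attach g p phi)); last first.
  by rewrite mul1r mul0r addr0.
have stE : stem (l, j) = p by rewrite /stem /= -iE.
rewrite /= stE -iE in sphi' *; symmetry.
have tat psi : smooth A psi -> forall v, test A (attach g p psi v).
  by move=> spsi; exact: attach_test.

apply: (pruned_value_linear (V := (V :\ k)%SET) (v := p) regF prO _
  (tat _ sphi'.1) (tat _ sphi.1) (tat _ sphi.1)).
- by rewrite in_setD1 pV eq_sym kNp.
- by move=> w _ wp; rewrite /attach (negbTE wp).
- by move=> w _ wp; rewrite /attach (negbTE wp).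
move=> chi schi; rewrite mul1r mul0r addr0 /attach eqxx.
have key h : dint mu (fun u => chi u * (g p u * h u))
    = dint mu (fun u => g p u * chi u * h u).
  by congr (dint mu _); apply/funext => u; rewrite mulrA (mulrC (chi u)).
have th : test A (fun u => g p u * chi u).
  by apply: testM => //; exact: atlas_open.
by rewrite !key -sphi.2 // -sphi'.2.
Qed.

Lemma eq_pruned_value F F' k0 V O f : pruning k0 V O ->
  (forall l, bend l \in V -> eend l \in V -> F l = F' l) ->
  pruned_value F k0 O f = pruned_value F' k0 O f.
Proof.
elim: O V f => [//|[l j] O IH] V f /= [pV kV kp prO] FE.
have -> : F l = F' l.
  by apply: FE; move: pV kV; rewrite /stem /leaf /lend; case: j {kp prO} => [[|[|j]]].
apply: (IH _ _ prO) => l'; rewrite !in_setD1 => /andP[_ ?] /andP[_ ?].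
exact: FE.
Qed.

End Evaluation.

(** * Ordered partitions and the insertion of a vertex *)

Section OrderedPartitions.
Variables (W : finType).
Implicit Types (V A : {set W}) (J : seq {set W}) (k p u v : W).

Fixpoint insertions k J : seq (seq {set W}) :=
  if J is A :: J1 then
    [:: [set k]%SET :: A :: J1, (k |: A)%SET :: J1
      & [seq A :: J0 | J0 <- insertions k J1]]
  else [:: [:: [set k]%SET]].

(** The set [V] is what remains to be covered, which opens proper sequences to induction on the
    blocks. *)
Fixpoint opart V J : bool :=
  if J is A :: J1 then
    [&& A != finset.set0, A \subset V & opart (V :\: A)%SET J1]
  else V == finset.set0.

Definition removal k J : seq {set W} :=
  [seq A <- [seq (B :\ k)%SET | B <- J] | A != finset.set0].

Lemma opart_notin V J k : opart V J -> k \notin V ->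
  all (fun A => k \notin A) J.
Proof.
elim: J V => [//|A J IH] V /= /and3P[_ AV oJ] kV.
rewrite (contra (fintype.subsetP AV k) kV) /=; apply: IH oJ _.
by rewrite finset.in_setD negb_and kV orbT.
Qed.

Lemma insertions_opart V J k J0 : k \in V -> opart (V :\ k)%SET J ->
  J0 \in insertions k J -> opart V J0.
Proof.
elim: J V J0 => [|A J IH] V J0 kV /=.
  move=> /eqP V0; rewrite inE => /eqP -> /=; rewrite finset.sub1set kV V0 eqxx /= andbT.
  by apply/finset.set0Pn; exists k; rewrite inE.
move=> /and3P[A0 AV oJ]; have kA : k \notin A.
  by apply: contraTN kV => /(fintype.subsetP AV); rewrite !inE eqxx.
have AV' : A \subset V by apply: fintype.subset_trans AV (subsetDl _ _).
rewrite !inE => /or3P[/eqP ->|/eqP ->|/mapP[J1 J1in ->]] /=.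
- rewrite A0 AV oJ finset.sub1set kV /= andbT.
  by apply/finset.set0Pn; exists k; rewrite inE.
- apply/and3P; split.
  + by apply/finset.set0Pn; exists k; rewrite !inE eqxx.
  + by rewrite finset.subUset finset.sub1set kV.
  + by rewrite -finset.setDDl.
- rewrite A0 AV' /=; apply: IH J1in; first by rewrite inE kA.
  by rewrite finset.setDDl finset.setUC -finset.setDDl.
Qed.

Lemma removal_id V J k : k \notin V -> opart V J -> removal k J = J.
Proof.
elim: J V => [//|A J IH] V kV /= /and3P[A0 AV oJ].
have kA : k \notin A by apply: contra kV; exact: (fintype.subsetP AV).
have AkE : (A :\ k)%SET = A.
  by apply/finset.setDidPl; rewrite disjoint_sym finset.disjoints1.
rewrite /removal /= AkE A0; congr (_ :: _); apply: IH oJ.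
by rewrite inE negb_and kV orbT.
Qed.

Lemma removal_insertions V J k J0 : k \notin V -> opart V J ->
  J0 \in insertions k J -> removal k J0 = J.
Proof.
elim: J V J0 => [|A J IH] V J0 kV.
  by move=> _; rewrite inE => /eqP ->; rewrite /removal /= finset.setDv eqxx.
move=> oAJ; have /= /and3P[A0 AV oJ] := oAJ.
have kA : k \notin A by apply: contra kV; exact: (fintype.subsetP AV).
have AkE : (A :\ k)%SET = A.
  by apply/finset.setDidPl; rewrite disjoint_sym finset.disjoints1.
have kVA : k \notin (V :\: A)%SET by rewrite inE negb_and kV orbT.
rewrite !inE => /or3P[/eqP ->|/eqP ->|/mapP[J1 J1in ->]].
- by rewrite -[RHS](removal_id kV oAJ) // /removal /= finset.setDv eqxx.
- rewrite /removal /= finset.setDUl finset.setDv finset.set0U AkE A0.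
  by congr (_ :: _); exact: removal_id oJ.
- by rewrite /removal /= AkE A0; congr (_ :: _); exact: IH oJ J1in.
Qed.

(** With [insertions_opart] and [removal_insertions], this shows that [removal k] maps the ordered
    partitions of [V] to those of [V] without [k], with fiber [insertions k J] over [J]. *)
Lemma opart_removal V J k : k \in V -> opart V J ->
  opart (V :\ k)%SET (removal k J) /\ J \in insertions k (removal k J).
Proof.
elim: J V => [|A J IH] V kV /=; first by move=> /eqP V0; rewrite V0 inE in kV.
move=> /and3P[A0 AV oJ]; have [kA|kA] := boolP (k \in A).
- have kVA : k \notin (V :\: A)%SET by rewrite inE kA.
  have rJ : removal k J = J by exact: removal_id oJ.
  rewrite /removal /= -/(removal k J) rJ.
  have [Ak0|Ak0] /= := eqVneq (A :\ k)%SET finset.set0.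
    have AE : A = [set k]%SET.
      by rewrite -(finset.setD1K kA) Ak0 finset.setU0.
    rewrite -AE oJ; split=> //.
    by case: (J) => [|B J'] /=; rewrite AE !inE eqxx.
  rewrite Ak0 finset.setSD //= finset.setDDl finset.setD1K // oJ; split=> //.
  by rewrite !inE !eqxx orbT.
- have AkE : (A :\ k)%SET = A.
    by apply/finset.setDidPl; rewrite disjoint_sym finset.disjoints1.
  rewrite /removal /= AkE A0 -/(removal k J).
  have [oR JR] := IH (V :\: A)%SET ltac:(by rewrite inE kA) oJ.
  split=> /=.
    rewrite A0 /=; apply/andP; split; last first.
      by rewrite finset.setDDl finset.setUC -finset.setDDl.
    by rewrite finset.subsetD1 AV.
  by rewrite !inE (mem_map (fun _ _ => _)) ?JR ?orbT // => ? ? [].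
Qed.

Lemma insertions_uniq V J k : k \notin V -> opart V J -> uniq (insertions k J).
Proof.
elim: J V => [//|A J IH] V kV /= /and3P[A0 AV oJ].
have kA : k \notin A by apply: contra kV; exact: (fintype.subsetP AV).
have hd (B : {set W}) J1 : k \in B -> B :: J1 \notin [seq A :: J0 | J0 <- insertions k J].
  by move=> kB; apply/mapP => -[J2 _ [BA _]]; rewrite -BA kB in kA.
apply/and3P; split.
- rewrite in_cons negb_or (hd [set k]%SET) ?inE // andbT.
  apply/eqP => -[kE _]; case/finset.set0Pn: A0 => a aA.
  have : a \in [set k]%SET by rewrite kE !inE aA orbT.
  by rewrite inE => /eqP ak; rewrite -ak aA in kA.
- by apply: hd; rewrite !inE eqxx.
- rewrite map_inj_uniq; last by move=> ? ? [].
  by apply: IH oJ; rewrite inE negb_and kV orbT.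
Qed.

Lemma block_insertions k J J0 u v : u != k -> v != k ->
  J0 \in insertions k J -> (block J0 u < block J0 v)%N = (block J u < block J v)%N.
Proof.
move=> uk vk; elim: J J0 => [|A J IH] J0.
  by rewrite inE => /eqP ->; rewrite /block /= !inE (negbTE uk) (negbTE vk).
rewrite !inE => /or3P[/eqP ->|/eqP ->|/mapP[J1 J1in ->]].
- by rewrite /block /= !inE (negbTE uk) (negbTE vk).
- by rewrite /block /= !inE (negbTE uk) (negbTE vk).
- rewrite /block /=; case: (u \in A); case: (v \in A) => //.
  by rewrite !ltnS; exact: IH.
Qed.

Lemma opart_size V J : opart V J -> (size J <= #|V|)%N.
Proof.
elim: J V => [//|A J IH] V /= /and3P[A0 AV oJ].
have := IH _ oJ; rewrite finset.cardsD (finset.setIidPr AV).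
have : (0 < #|A|)%N by rewrite card_gt0.
by have := subset_leq_card AV; lia.
Qed.

Lemma opart_proper_sequence J : opart [set: W]%SET J = proper_sequence J.
Proof.
rewrite /proper_sequence.
suff gen V : opart V J = [&& all (fun A : {set W} => A != finset.set0) J,
    pairwise (fun A B : {set W} => (A :&: B)%SET == finset.set0) J
    & (\bigcup_(A <- J) A)%SET == V] by exact: gen.
elim: J V => [|A J IH] V /=; first by rewrite big_nil eq_sym.
rewrite big_cons IH; case: (A != finset.set0) => //=.
have [aJ|aJ] := boolP (all (fun B => (A :&: B)%SET == finset.set0) J); last first.
  rewrite /= andbF; apply/negbTE; apply: contra aJ => /and4P[AV _ _ /eqP JV].
  apply/allP => B BJ; rewrite finset.setI_eq0 disjoint_sym.
  have : B \subset (V :\: A)%SET by rewrite -JV (big_rem B) //= finset.subsetUl.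
  by rewrite finset.subsetD => /andP[].
case: (all _ J) => /=; last by rewrite andbF.
case: (pairwise _ J) => /=; last by rewrite andbF.
have dAJ : (A :&: \bigcup_(B <- J) B)%SET = finset.set0.
  by rewrite big_distrr big_seq big1 // => B /(allP aJ)/eqP.
apply/andP/eqP => [[AV /eqP ->]|<-].
  by rewrite -{1}(finset.setIidPr AV) finset.setID.
rewrite finset.subsetUl finset.setDUl finset.setDv finset.set0U; split=> //.
by apply/eqP/esym/finset.setDidPl; rewrite -finset.setI_eq0 finset.setIC dAJ.
Qed.

End OrderedPartitions.

(** * Signed sums over the insertions of one vertex *)

Section FiberSums.
Variables (R : realDomainType) (K : comNzRingType) (W : finType).
Implicit Types (V A : {set W}) (J : seq {set W}) (k p : W) (s : W -> R).

Definition weight s A : R := \sum_(j in A) s j.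

(** The number [a] is the weight of the blocks already passed. For the weights of a cell, a
    non-positive partial sum says that a proper initial union lies in the opposite cell. *)
Fixpoint admissible s (a : R) J : bool :=
  if J is A :: J1 then
    (a + weight s A <= 0) && admissible s (a + weight s A) J1
  else true.

Definition merge s k p : W -> R := fun v => if v == p then s p + s k else s v.

Lemma weight1 s k : weight s [set k]%SET = s k.
Proof. by rewrite /weight big_set1. Qed.

Lemma weightU1 s k A : k \notin A -> weight s (k |: A)%SET = s k + weight s A.
Proof. by move=> kA; rewrite /weight big_setU1. Qed.

Lemma weightD s A V : A \subset V ->
  weight s V = weight s A + weight s (V :\: A)%SET.
Proof.
by move=> /finset.setIidPr AV; rewrite /weight (big_setID A) /= AV.
Qed.

Lemma weight_merge_in s k p A : p \in A ->
  weight (merge s k p) A = weight s A + s k.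
Proof.
move=> pA; rewrite /weight (bigD1 p) //= [in RHS](bigD1 p) //= /merge eqxx.
rewrite -!addrA (addrC (s k)); congr (_ + (_ + _)).
by apply: eq_bigr => v /andP[_ /negbTE ->].
Qed.

Lemma weight_merge_notin s k p A : p \notin A ->
  weight (merge s k p) A = weight s A.
Proof.
move=> pA; apply: eq_bigr => v vA; rewrite /merge; case: eqP => // vp.
by rewrite vp (negbTE pA) in vA.
Qed.

Lemma admissible_merge s k p a J : all (fun A => p \notin A) J ->
  admissible (merge s k p) a J = admissible s a J.
Proof.
by elim: J a => [//|A J IH] a /= /andP[pA pJ]; rewrite weight_merge_notin // IH.
Qed.

Lemma admissible_total s V a J : opart V J -> a <= 0 -> admissible s a J ->
  a + weight s V <= 0.
Proof.
elim: J V a => [|A J IH] V a /=.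
  by move=> /eqP -> a0 _; rewrite /weight finset.big_set0 addr0.
move=> /and3P[_ AV oJ] _ /andP[aA]; have := IH _ _ oJ aA => /[apply].
by rewrite -addrA -weightD.
Qed.

(** The exponent is the length, not the length minus one, so that each block contributes a factor
    -1; the coefficients in [retarded] are the opposites. *)
Definition term s a J : K := (-1) ^+ size J * (admissible s a J)%:R.

Lemma term_merge s k p a J : all (fun A => p \notin A) J ->
  term (merge s k p) a J = term s a J.
Proof. by move=> pJ; rewrite /term admissible_merge. Qed.

Lemma term_cons s a A J :
  term s a (A :: J) = - (a + weight s A <= 0)%R%:R * term s (a + weight s A) J.
Proof.
rewrite /term /= exprS mulN1r !mulNr; congr (- _).
by rewrite -mulnb natrM mulrCA.
Qed.

(** For positive [s k], a new block right after [A] is admissible exactly when [k] merged into [A]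
    is, with opposite sign. Only the new block in front of all others survives. *)
Lemma sum_insertions_pos s k a J : 0 < s k -> all (fun A => k \notin A) J ->
  \sum_(J0 <- insertions k J) term s a J0 =
  - (a + s k <= 0)%R%:R * term s (a + s k) J.
Proof.
move=> sk; elim: J a => [|A J IH] a /=.
  by move=> _; rewrite big_seq1 term_cons weight1.
move=> /andP[kA kJ]; rewrite !big_cons big_map.
under eq_bigr do rewrite term_cons.
rewrite -big_distrr /= IH // !term_cons weight1 weightU1 //.
rewrite !addrA !(addrAC a (weight s A) (s k)).
case: (leP (a + s k + weight s A) 0) => [le|_]; last by rewrite /=; ring.

have -> : a + weight s A <= 0.
  by apply: le_trans le; rewrite addrAC lerDl ltW.
by rewrite /=; ring.
Qed.

(** For negative [s k], the new block right before [A] cancels the merging into [A]. Only the new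
    block at the very end survives, and it adds no condition. *)
Lemma sum_insertions_neg s k a J : s k < 0 -> a <= 0 ->
  all (fun A => k \notin A) J ->
  \sum_(J0 <- insertions k J) term s a J0 = - term s a J.
Proof.
move=> sk; have addk (b : R) : b <= 0 -> b + s k <= 0.
  by move=> b0; rewrite -[leRHS]addr0 lerD // ltW.
elim: J a => [|A J IH] a a0 /=.
  by move=> _; rewrite big_seq1 term_cons weight1 addk // /term /=; ring.
move=> /andP[kA kJ]; rewrite !big_cons big_map.
under eq_bigr do rewrite term_cons.
rewrite -big_distrr /= !term_cons weight1 weightU1 // addk // !addrA.
case: (leP (a + weight s A) 0) => [le|_]; last by rewrite /=; ring.
by rewrite IH //=; ring.
Qed.

Variables (x t y : K).

(** In the application, [x], [t] and [y] are the values of the whole product when the line joining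
    [k] to [p] carries the factor for [k] before, with or after [p]. *)
Definition relative k p J : K :=
  if block J k == block J p then t
  else if (block J k < block J p)%N then x else y.

Lemma relative_head k p J : p != k -> relative k p ([set k]%SET :: J) = x.
Proof.
by move=> pk; rewrite /relative /block /= !inE eqxx (negbTE pk).
Qed.

Lemma relative_cons k p A J : k \notin A -> p \notin A ->
  relative k p (A :: J) = relative k p J.
Proof.
by move=> kA pA; rewrite /relative /block /= (negbTE kA) (negbTE pA) eqSS ltnS.
Qed.

Lemma relative_same k p A J : k \in A -> p \in A -> relative k p (A :: J) = t.
Proof. by move=> kA pA; rewrite /relative /block /= kA pA. Qed.

Lemma relative_before k p A J : k \in A -> p \notin A ->
  relative k p (A :: J) = x.
Proof. by move=> kA pA; rewrite /relative /block /= kA (negbTE pA). Qed.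

Lemma relative_after k p A J : k \notin A -> p \in A ->
  relative k p (A :: J) = y.
Proof. by move=> kA pA; rewrite /relative /block /= (negbTE kA) pA. Qed.

(* Making [k] a new block changes the parity of the length, so it cancels the
   insertion of [k] into a neighbouring block, except around the block of [p],
   where the two carry different factors. *)
Lemma fiber_sum_neg s k p V a J : s k < 0 -> a <= 0 -> k \notin V -> p \in V ->
  opart V J -> a + weight s V + s k = 0 ->
  \sum_(J0 <- insertions k J) term s a J0 * relative k p J0 =
  term (merge s k p) a J * (t - x).
Proof.
move=> sk a0 kV pV oJ; have := opart_notin oJ kV.
have pk : p != k by apply: contraNneq kV => <-.
have addk (b : R) : b <= 0 -> b + s k <= 0.
  by move=> b0; rewrite -[leRHS]addr0 lerD // ltW.
elim: J V a a0 {kV} pV oJ => [|A J IH] V a a0 pV /=.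
  by move=> /eqP V0; rewrite V0 inE in pV.
move=> /and3P[_ AV oJ] /andP[kA kJ] tot; rewrite !big_cons big_map.
rewrite relative_head // !term_cons weight1 weightU1 // addk // !addrA.
have {}tot : a + weight s A + weight s (V :\: A)%SET + s k = 0.
  by rewrite -(addrA a) -weightD.
have [pA|pA] := boolP (p \in A).
- rewrite relative_same ?inE ?eqxx ?pA ?orbT // weight_merge_in // !addrA.
  rewrite !(addrAC a (weight s A) (s k)).
  under eq_bigr do rewrite relative_after // term_cons -mulrA.
  rewrite -big_distrr -big_distrl /=.
  rewrite term_merge; last by apply: opart_notin oJ _; rewrite inE pA.
  case: (leP (a + weight s A) 0) => [le|_]; last by rewrite /term /=; ring.
  (* Together with [a], the blocks without [k] weigh [- s k], which is positive, so the sequence is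
     not admissible: the insertions after the block of [p] sum to zero. *)
  have tA0 : term s (a + weight s A) J = 0.
    rewrite /term; case: (boolP (admissible s _ J)) => [adm|_]; last first.
      by rewrite mulr0.
    have := admissible_total oJ le adm.
    by move/eqP: tot; rewrite addr_eq0 => /eqP ->; rewrite oppr_le0 leNgt sk.
  by rewrite sum_insertions_neg // tA0 /=; ring.
- rewrite relative_before ?inE ?eqxx ?negb_or ?pk //.
  rewrite weight_merge_notin //.
  under eq_bigr do rewrite relative_cons // term_cons -mulrA.
  rewrite -big_distrr /=.
  case: (leP (a + weight s A) 0) => [le|_]; last by rewrite /term /=; ring.
  rewrite (IH (V :\: A)%SET) //; last by rewrite inE pA.
  by rewrite /=; ring.
Qed.

(** The insertions after [p] telescope to the factor [y]. Those before [p] leave a new block in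
    front of everything: this last term is kept for the induction on the blocks, and it vanishes at
    [a = 0]. *)
Lemma fiber_sum_pos s k p V a J : 0 < s k -> k \notin V -> p \in V ->
  opart V J ->
  \sum_(J0 <- insertions k J) term s a J0 * relative k p J0 =
  term (merge s k p) a J * (t - y) - (a + s k <= 0)%R%:R * term s (a + s k) J * x.
Proof.
move=> sk kV pV oJ; have := opart_notin oJ kV.
have pk : p != k by apply: contraNneq kV => <-.
elim: J V a {kV} pV oJ => [|A J IH] V a pV /=.
  by move=> /eqP V0; rewrite V0 inE in pV.
move=> /and3P[_ AV oJ] /andP[kA kJ]; rewrite !big_cons big_map.
rewrite relative_head // !term_cons weight1 weightU1 // !addrA.
have addk : (a + s k + weight s A <= 0) -> (a + weight s A <= 0).
  by move=> le; apply: le_trans le; rewrite addrAC lerDl ltW.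
have [pA|pA] := boolP (p \in A).
- rewrite relative_same ?inE ?eqxx ?pA ?orbT // weight_merge_in // !addrA.
  under eq_bigr do rewrite relative_after // term_cons -mulrA.
  rewrite -big_distrr -big_distrl /= sum_insertions_pos // !(addrAC a (weight s A) (s k)).
  rewrite term_merge; last by apply: opart_notin oJ _; rewrite inE pA.
  case: (leP (a + s k + weight s A) 0) => [/addk ->|_]; by rewrite /term /=; ring.
- rewrite relative_before ?inE ?eqxx ?negb_or ?pk //.
  rewrite weight_merge_notin //.
  under eq_bigr do rewrite relative_cons // term_cons -mulrA.
  rewrite -big_distrr /= (IH (V :\: A)%SET) //; last by rewrite inE pA.
  rewrite !(addrAC a (weight s A) (s k)).
  case: (leP (a + s k + weight s A) 0) => [/addk ->|_]; by rewrite /term /=; ring.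
Qed.

End FiberSums.

(** * Linear combinations of partially regular distributions *)

Section Combinations.
Variables (R : realType) (d : nat) (M : manifold R d) (mu : density M) (n : nat).
Local Notation A := (power_atlas (M := M) (n := n)).
Implicit Types (F G : functional R 'rV[M]_n) (c : R[i]).

Lemma distributionD F G c : Defs.distribution A F -> Defs.distribution A G ->
  Defs.distribution A (fun f => F f + c * G f).
Proof.
move=> [linF cF] [linG cG]; split.
  by move=> a f g tf tg; rewrite linF // linG //; ring.
move=> u u0; have [Fr Fi] := cF u u0; have [Gr Gi] := cG u u0.
have lim0 (a b : R) (v1 v2 v3 : nat -> R) :
    v1 @ \oo --> (0 : R) -> v2 @ \oo --> (0 : R) -> v3 @ \oo --> (0 : R) ->
    (fun k => v1 k + (a * v2 k + b * v3 k)) @ \oo --> (0 : R).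
  move=> h1 h2 h3; have -> : 0 = 0 + (a * 0 + b * 0) by rewrite !mulr0 !addr0.
  exact: (cvgD h1 (cvgD (cvgM (cvg_cst a) h2) (cvgM (cvg_cst b) h3))).
split.
- rewrite (_ : (fun k => _) = fun k => complex.Re (F (u k)) +
    (complex.Re c * complex.Re (G (u k)) + - complex.Im c * complex.Im (G (u k)))).
    exact: lim0.
  by apply/funext => k; case: (F _) => ? ?; case: (G _) => ? ?; case: (c) => ? ? /=;
    rewrite mulNr.
- rewrite (_ : (fun k => _) = fun k => complex.Im (F (u k)) +
    (complex.Re c * complex.Im (G (u k)) + complex.Im c * complex.Re (G (u k)))).
    exact: lim0.
  by apply/funext => k; case: (F _) => ? ?; case: (G _) => ? ?; case: (c).
Qed.

Lemma distribution0 : Defs.distribution A (fun=> 0).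
Proof.
split; first by move=> a f g _ _; rewrite mulr0 addr0.
by move=> u _; split; exact: cvg_cst.
Qed.

Lemma partially_regularD F G c : partially_regular mu F ->
  partially_regular mu G -> partially_regular mu (fun f => F f + c * G f).
Proof.
move=> regF regG i g tg.
have [phi [sphi phiE]] := regF i g tg; have [psi [spsi psiE]] := regG i g tg.
have op := @atlas_open _ _ M.
exists (fun u => phi u + c * psi u); split.
  have scst := @smooth_cst _ _ _ _ (@atlas R d M) c.
  have scpsi : smooth (@atlas R d M) (fun u => c * psi u) := smoothM op scst spsi.
  exact: (smoothD op sphi scpsi).
move=> h th; rewrite phiE // psiE // addrC -dintD; last 2 first.
- exact: (testM op).
- exact: (testM op).
by congr (dint mu _); apply/funext => u; ring.
Qed.

Lemma partially_regular0 : partially_regular mu (fun _ : 'rV[M]_n -> R[i] => 0).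
Proof.
move=> i g tg; exists (fun=> 0); split; first exact: smooth_cst.
move=> h th; rewrite -[LHS](dint0 mu); congr (dint mu _).
by apply/funext => u; rewrite mulr0.
Qed.

Lemma distribution_sum (I : eqType) (r : seq I) (c : I -> R[i])
    (F : I -> functional R 'rV[M]_n) : {in r, forall i, Defs.distribution A (F i)} ->
  Defs.distribution A (fun f => \sum_(i <- r) c i * F i f).
Proof.
elim: r => [_|i r IH rF].
  rewrite (_ : (fun f => _) = fun=> 0); first exact: distribution0.
  by apply/funext => f; rewrite big_nil.
rewrite (_ : (fun f => _) = fun f => (\sum_(j <- r) c j * F j f) + c i * F i f).
  apply: distributionD; last by apply: rF; exact: mem_head.
  by apply: IH => j jr; apply: rF; rewrite inE jr orbT.
by apply/funext => f; rewrite big_cons addrC.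
Qed.

Lemma partially_regular_sum (I : eqType) (r : seq I) (c : I -> R[i])
    (F : I -> functional R 'rV[M]_n) :
  {in r, forall i, partially_regular mu (F i)} ->
  partially_regular mu (fun f => \sum_(i <- r) c i * F i f).
Proof.
elim: r => [_|i r IH rF].
  rewrite (_ : (fun f => _) = fun=> 0); first exact: partially_regular0.
  by apply/funext => f; rewrite big_nil.
rewrite (_ : (fun f => _) = fun f => (\sum_(j <- r) c j * F j f) + c i * F i f).
  apply: partially_regularD; last by apply: rF; exact: mem_head.
  by apply: IH => j jr; apply: rF; rewrite inE jr orbT.
by apply/funext => f; rewrite big_cons addrC.
Qed.

End Combinations.

(** * The identity between products along the tree, by induction on the pruning *)

Section TreeIdentity.
Variables (R : realType) (d : nat) (M : manifold R d) (mu : density M).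
Variables (n : nat) (Q : rel 'I_n) (t wp wm : line Q -> two_point M).
Hypothesis reg_t : forall l, partially_regular mu (t l).
Hypothesis reg_wp : forall l, partially_regular mu (wp l).
Hypothesis reg_wm : forall l, partially_regular mu (wm l).
Local Notation A := (@atlas R d M).
Local Notation factor := (ordered_factor t wp wm).

(** Vertices are put back in the reverse order of their removal, so that a sum over ordered
    partitions becomes an iterated sum over insertions. *)
Fixpoint orderings (k0 : 'I_n) (O : seq (line Q * 'I_2)) : seq (seq {set 'I_n}) :=
  if O is s :: O' then
    [seq J | J' <- orderings k0 O', J <- insertions (leaf s) J']
  else [:: [:: [set k0]%SET]].

Lemma orderingsP k0 V O J : pruning k0 V O -> (J \in orderings k0 O) = opart V J.
Proof.
elim: O V J => [|s O IH] V J /=.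
  move=> ->; rewrite inE; case: J => [|B J] /=.
    by apply/esym/negbTE/finset.set0Pn; exists k0; rewrite inE.
  rewrite eqseq_cons finset.subset1.
  have [->|Bk] := eqVneq B [set k0]%SET; last first.
    by rewrite /=; case: (B == finset.set0).
  have -> : ([set k0]%SET != finset.set0 :> {set 'I_n}).
    by apply/finset.set0Pn; exists k0; rewrite inE.
  rewrite finset.setDv /=; case: J => [|B' J] /=.
    by rewrite ?eqxx.
  by rewrite finset.subset0; case: (B' == finset.set0).
move=> [pV kV _ prO]; apply/allpairsPdep/idP => [[J' [J0 []]]|oJ].
  by rewrite (IH _ _ prO) => oJ' J0in ->; exact: insertions_opart oJ' J0in.
have [oR Jin] := opart_removal kV oJ.
by exists (removal (leaf s) J), J; rewrite (IH _ _ prO).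
Qed.

Lemma orderings_uniq k0 V O : pruning k0 V O -> uniq (orderings k0 O).
Proof.
elim: O V => [//|s O IH] V /= [pV kV _ prO].
have kVk : leaf s \notin (V :\ leaf s)%SET by rewrite !inE eqxx.
apply: allpairs_uniq_dep; first exact: IH prO.
  by move=> J; rewrite (orderingsP _ prO) => oJ; exact: insertions_uniq oJ.
move=> [J1 J1'] [J2 J2'] /allpairsPdep[a1 [b1 [a1in b1in [-> ->]]]].
move=> /allpairsPdep[a2 [b2 [a2in b2in [-> ->]]]] /= bE.
rewrite !(orderingsP _ prO) in a1in a2in.
have aE : a1 = a2.
  by rewrite -(removal_insertions kVk a1in b1in) bE (removal_insertions kVk a2in b2in).
by rewrite aE bE.
Qed.

(** [wp] is the factor for [bend] before [eend]; its role relative to the leaf depends on which end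
    is removed. *)
Definition leaf_first (s : line Q * 'I_2) : two_point M :=
  if s.2 == ord0 then wp s.1 else wm s.1.
Definition leaf_last (s : line Q * 'I_2) : two_point M :=
  if s.2 == ord0 then wm s.1 else wp s.1.

Lemma factor_leaf J s : factor J s.1 =
  if block J (leaf s) == block J (stem s) then t s.1
  else if (block J (leaf s) < block J (stem s))%N then leaf_first s
  else leaf_last s.
Proof.
case: s => l [[|[|j]] jP] //=; rewrite /ordered_factor /leaf_first /leaf_last
  /leaf /stem /lend //=.
by rewrite eq_sym; case: ltngtP.
Qed.

Lemma factor_insertions k J J0 l : J0 \in insertions k J ->
  bend l != k -> eend l != k -> factor J0 l = factor J l.
Proof.
move=> J0in bk ek; rewrite /ordered_factor.
have := block_insertions bk ek J0in; have := block_insertions ek bk J0in.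
by case: (ltngtP (block J0 _)); case: (ltngtP (block J _)).
Qed.

Variable r : line Q -> two_point M.

(** At each stage [w] is the merged weight, and the sign of [w (leaf s)] selects the two-point
    function left by the sum over the insertions of the leaf. *)
Fixpoint compatible (w : 'I_n -> R) (O : seq (line Q * 'I_2)) : Prop :=
  if O is s :: O' then
    [/\ w (leaf s) != 0,
        w (leaf s) < 0 -> r s.1 = fun f => t s.1 f - leaf_first s f,
        0 < w (leaf s) -> r s.1 = fun f => t s.1 f - leaf_last s f
      & compatible (merge w (leaf s) (stem s)) O']
  else True.

Lemma reg_factor J l : partially_regular mu (factor J l).
Proof. by rewrite /ordered_factor; case: ifP => // _; case: ifP. Qed.

Lemma partially_regularB (F G : two_point M) : partially_regular mu F ->
  partially_regular mu G -> partially_regular mu (fun f => F f - G f).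
Proof.
move=> regF regG; rewrite (_ : (fun f => _) = fun f => F f + (-1) * G f).
  exact: partially_regularD.
by apply/funext => f; rewrite mulN1r.
Qed.

Lemma pruned_valueB (F : line Q -> two_point M) k0 V O f p (G H : two_point M) i g :
  (forall l, partially_regular mu (F l)) -> pruning k0 V O -> p \in V ->
  (forall v, test A (f v)) -> test A g ->
  partially_regular mu G -> partially_regular mu H ->
  pruned_value mu F k0 O
    (attach f p (smear mu (fun f => G f - H f) i g)) =
  pruned_value mu F k0 O (attach f p (smear mu G i g)) -
  pruned_value mu F k0 O (attach f p (smear mu H i g)).
Proof.
move=> regF prO pV tf tg regG regH.
have sG := smearP i regG tg; have sH := smearP i regH tg.
have sB := smearP i (partially_regularB regG regH) tg.
have tat phi : smooth A phi -> forall v, test A (attach f p phi v).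
  by move=> sphi; exact: attach_test.
rewrite -[X in X - _]mul1r -[X in _ - X]mul1r -mulNr.
apply: (pruned_value_linear (v := p) regF prO pV
  (tat _ sB.1) (tat _ sG.1) (tat _ sH.1)).
- by move=> w _ w_p; rewrite /attach (negbTE w_p).
- by move=> w _ w_p; rewrite /attach (negbTE w_p).
move=> chi schi; rewrite mul1r mulN1r /attach eqxx.
have key h : dint mu (fun u => chi u * (f p u * h u))
    = dint mu (fun u => f p u * chi u * h u).
  by congr (dint mu _); apply/funext => u; rewrite mulrA (mulrC (chi u)).
have th : test A (fun u => f p u * chi u) := testM (@atlas_open _ _ M) (tf p) schi.
by rewrite !key -sB.2 // -sG.2 // -sH.2.
Qed.

(** Summing over the insertions of one leaf puts [r] on its line and replaces the weights by the
    merged ones, whose total is again zero. The last vertex forms one block of weight zero, hence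
    the minus sign. *)
Lemma tree_identity k0 V O w f : pruning k0 V O -> compatible w O ->
  weight w V = 0 -> (forall v, test A (f v)) ->
  \sum_(J <- orderings k0 O) term _ w 0 J * pruned_value mu (factor J) k0 O f =
  - pruned_value mu r k0 O f.
Proof.
elim: O V w f => [|s O IH] V w f.
  move=> /= -> _; rewrite weight1 => w0 tf; rewrite big_seq1.
  by rewrite /term /= weight1 add0r w0 lexx expr1 mulr1 mulN1r.
move=> /= [pV kV kp prO] [wk0 rneg rpos cO] wV tf.
set k := leaf s in kV kp prO wk0 rneg rpos cO *.
set p := stem s in pV kp cO *.
have pk : p != k by rewrite eq_sym; exact: leaf_stem.
have pVk : p \in (V :\ k)%SET by rewrite in_setD1 pk.
have kVk : k \notin (V :\ k)%SET by rewrite !inE eqxx.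
have wVk : weight w (V :\ k)%SET + w k = 0.
  have k_V : [set k]%SET \subset V by rewrite finset.sub1set.
  by rewrite addrC -(weight1 w k) -(weightD w k_V).
have regl : partially_regular mu (leaf_first s) /\ partially_regular mu (leaf_last s).
  by rewrite /leaf_first /leaf_last; case: ifP.
pose val (F : line Q -> two_point M) G :=
  pruned_value mu F k0 O (attach f p (smear mu G (rev_ord s.2) (f k))).
have regr : partially_regular mu (r s.1).
  case: (ltgtP (w k) 0) wk0 => // wk _.
    by rewrite rneg //; apply: partially_regularB; [exact: reg_t|exact: regl.1].
  by rewrite rpos //; apply: partially_regularB; [exact: reg_t|exact: regl.2].
rewrite -(IH _ _ _ prO cO); last 2 first.
- by rewrite weight_merge_in.
- exact: (attach_test p tf (smearP _ regr (tf k)).1).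
rewrite big_allpairs_dep /=; apply: eq_big_seq => J.
rewrite (orderingsP _ prO) => oJ.
(* For fixed [J], the factors of the lines away from [k] do not depend on the place of [k]; only the
   factor of [s.1] varies. *)
transitivity (\sum_(J0 <- insertions k J) term R[i] w 0 J0 *
  relative (val (factor J) (leaf_first s)) (val (factor J) (t s.1))
    (val (factor J) (leaf_last s)) k p J0).
  apply: eq_big_seq => J0 J0in; congr (_ * _).
  transitivity (val (factor J) (factor J0 s.1)).
    apply: (eq_pruned_value _ _ prO) => l.
    rewrite !in_setD1 => /andP[bk _] /andP[ek _].
    exact: (factor_insertions J0in).
  rewrite factor_leaf /relative -/k -/p.
  by case: ifP => // _; case: ifP.
have valB G : partially_regular mu G ->
    val (factor J) (fun f => t s.1 f - G f) =
    val (factor J) (t s.1) - val (factor J) G.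
  move=> regG; exact: (pruned_valueB _ (reg_factor J) prO pVk tf (tf k)
    (reg_t s.1) regG).
case: (ltgtP (w k) 0) wk0 => // wk _.
- rewrite (fiber_sum_neg _ _ _ wk (lexx 0) kVk pVk oJ) ?add0r //.
  by rewrite -/(val _ (r s.1)) (rneg wk) (valB _ regl.1).
- rewrite (fiber_sum_pos _ _ _ _ wk kVk pVk oJ) add0r leNgt wk /= !mul0r.
  by rewrite subr0 -/(val _ (r s.1)) (rpos wk) (valB _ regl.2).
Qed.

End TreeIdentity.

(** * The two sides of a line as fibers of the merging *)

Section Sides.
Variables (n : nat) (Q : rel 'I_n).
Hypothesis Q_sym : symmetric Q.
Implicit Types (V : {set 'I_n}) (pi : 'I_n -> 'I_n) (s : line Q * 'I_2).

(* [pi] records the merging of the pruned vertices with the vertices of [V] that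
   carried them. *)
Definition retraction V pi : Prop :=
  [/\ forall v, v \in V -> pi v = v,
      forall u v, Q u v -> pi u = pi v \/ (u \in V /\ v \in V)
    & forall v, connect [rel a b | Q a b && (pi a == pi b)] v (pi v)].

Definition fiber pi (v : 'I_n) : {set 'I_n} := [set u | pi u == v]%SET.

Lemma retraction_id : retraction [set: 'I_n]%SET id.
Proof.
by split=> [//|u v _|v]; [right; rewrite !inE|exact: connect0].
Qed.

Lemma line_edge s : Q (leaf s) (stem s).
Proof.
case: s => l j; have /andP[_] := valP l; rewrite /leaf /stem /lend.
by case: j => [[|[|j]] jP] //=; rewrite Q_sym.
Qed.

Lemma retraction_prune V pi s : retraction V pi ->
  leaf s \in V -> stem s \in V ->
  (forall v, v \in V -> Q (leaf s) v -> v = stem s) ->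
  retraction (V :\ leaf s)%SET
    (fun v => if pi v == leaf s then stem s else pi v).
Proof.
set k := leaf s; set p := stem s => -[piV piQ piC] kV pV kp.
have kNp : k != p by exact: leaf_stem.
have pNk : (p == k) = false by rewrite eq_sym; exact/negbTE.
split.
- by move=> v; rewrite in_setD1 => /andP[/negbTE vk vV]; rewrite piV // vk.
- move=> u v uv; have [->|[uV vV]] := piQ _ _ uv; first by left.
  rewrite !piV // !in_setD1 uV vV.
  have [uk|uk] := eqVneq u k.
    have vp : v = p by apply: kp => //; rewrite -uk.
    by left; rewrite vp pNk.
  have [vk|vk] := eqVneq v k; last by right.
  by left; apply: kp => //; rewrite Q_sym -vk.
- move=> v.
  have sub : subrel [rel a b | Q a b && (pi a == pi b)]
      (connect [rel a b | Q a b && ((if pi a == k then p else pi a)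
                                    == (if pi b == k then p else pi b))]).
    by move=> a b /= /andP[ab /eqP e]; apply: connect1 => /=; rewrite ab e eqxx.
  have c := connect_sub sub (piC v).
  case: eqP => // pvk; apply: connect_trans c _; rewrite pvk.
  by apply: connect1 => /=; rewrite line_edge !piV // eqxx pNk eqxx.
Qed.

Lemma sever_sym (l : line Q) : symmetric (sever l).
Proof.
move=> u v; rewrite /sever /= Q_sym; congr (_ && _).
by rewrite andbC !xpair_eqE; congr (~~ _ && ~~ _); exact: andbC.
Qed.

Lemma leaf_stem_bend_eend s : (leaf s, stem s) = (bend s.1, eend s.1) \/
  (stem s, leaf s) = (bend s.1, eend s.1).
Proof. by case: s => l [[|[|j]] jP] //=; [left|right]. Qed.

(** The severed line joins two different fibers, so the fiber of the leaf stays connected after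
    severing; and no other line leaves this fiber. It is therefore the side of the line that
    contains the leaf. *)
Lemma Bside_fiber V pi s : (forall u v, connect Q u v) -> retraction V pi ->
  leaf s \in V -> stem s \in V ->
  (forall v, v \in V -> Q (leaf s) v -> v = stem s) ->
  Bside s.1 = if s.2 == ord0 then fiber pi (leaf s) else (~: fiber pi (leaf s))%SET.
Proof.
set k := leaf s; set p := stem s => Qc [piV piQ piC] kV pV kp.
have kNp : k != p by exact: leaf_stem.
have closedK u v : connect (sever s.1) u v -> (pi u == k) = (pi v == k).
  move=> uv; have cl : fingraph.closed (sever s.1) [pred v | pi v == k].
    move=> a b /= /and3P[ab nbe neb]; rewrite !inE.
    have [-> //|[aV bV]] := piQ _ _ ab.
    have lk : (a, b) != (k, p) /\ (a, b) != (p, k).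
      have [e|e] := leaf_stem_bend_eend s; rewrite -/k -/p in e.
        by rewrite e; split=> //; case: e neb => -> ->.
      by rewrite e; split=> //; case: e neb => -> ->.
    rewrite !piV //; case: lk; rewrite !xpair_eqE.
    have [ak|ak] := eqVneq a k.
      by rewrite ak in ab; rewrite (kp b bV ab) eqxx.
    have [bk|bk] := eqVneq b k => //.
    by rewrite bk Q_sym in ab; rewrite (kp a aV ab) eqxx.
  exact: (closed_connect cl uv).
have reach v : pi v = k -> connect (sever s.1) k v.
  move=> vk; rewrite (sym_connect_sym (sever_sym _)) -vk.
  apply: connect_sub (piC v) => a b /= /andP[ab /eqP piab]; apply: connect1.
  rewrite /sever /= ab /=.
  have nkp : (a, b) != (k, p) /\ (a, b) != (p, k).
    by split; apply/eqP => -[ak bp]; move: piab; rewrite ak bp !piV // => /eqP;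
      rewrite ?(eq_sym p) (negbTE kNp).
  by have [e|e] := leaf_stem_bend_eend s; case: e nkp => <- <- [-> ->].
(* After severing, every vertex is still connected to one of the two ends; this gives the complement
   when the leaf is [eend]. *)
have two v : connect (sever s.1) (bend s.1) v \/ connect (sever s.1) (eend s.1) v.
  apply/orP; have cl : fingraph.closed Q [pred v | connect (sever s.1) (bend s.1) v
                                   || connect (sever s.1) (eend s.1) v].
    apply: intro_closed; first by move=> a b; exact: (sym_connect_sym Q_sym).
    move=> a b ab; rewrite !inE.
    have [[-> ->]|nbe] := eqVneq (a, b) (bend s.1, eend s.1).
      by rewrite !connect0 orbT.
    have [[-> ->]|neb] := eqVneq (a, b) (eend s.1, bend s.1).
      by rewrite !connect0.
    have sab : connect (sever s.1) a b.
      by apply: connect1; rewrite /sever /= ab nbe neb.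
    by move=> /orP[] c; rewrite (connect_trans c sab) ?orbT.
  have := closed_connect cl (Qc (bend s.1) v); rewrite !inE connect0 /=.
  by move=> <-.
apply/setP => v; rewrite inE.
have pik : pi k = k by exact: piV.
have pip : pi p = p by exact: piV.
case: ifP => j0; rewrite !inE.
- have kb : k = bend s.1 by rewrite /k /leaf /lend j0.
  apply/idP/eqP; first by move=> /closedK; rewrite -kb pik eqxx => /esym/eqP.
  by rewrite -kb; exact: reach.
- have ke : k = eend s.1 by rewrite /k /leaf /lend j0.
  have pb : p = bend s.1.
    by rewrite /p /stem /lend; case: (s.2) j0 => [[|[|j]] jP].
  apply/idP/idP.
    by move=> /closedK; rewrite -pb pip eq_sym (negbTE kNp) => <-.
  move=> vk; have [//|] := two v; rewrite -ke => /closedK.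
  by rewrite pik eqxx => /esym; rewrite (negbTE vk).
Qed.

(** An extremity can be pruned first, when nothing has been merged and its fiber is a singleton. *)
Lemma Bside_extremity (l : line Q) : irreflexive Q ->
  (forall u v, connect Q u v) -> extremity Q (eend l) ->
  Bside l = (~: [set eend l])%SET.
Proof.
move=> Q_irr Qc [l0 [l0e l0u]].
have uniqv v : Q (eend l) v -> v = bend l.
  move=> ev; have evN : eend l != v.
    by apply/eqP => evE; rewrite -evE Q_irr in ev.
  have ll0 : l0 = l by apply: l0u; right.
  rewrite {}ll0 {l0 l0e} in l0u.
  case: (ltngtP (eend l) v) evN => [lt _|lt _|/val_inj ->]; last by rewrite eqxx.
    have P : (eend l < v)%N && Q (eend l) v by rewrite lt.
    have le : l = exist _ (eend l, v) P by apply: l0u; left.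
    have /andP[] := valP l; rewrite -/(bend l) -/(eend l).
    have -> : bend l = eend l by rewrite {1}le.
    by rewrite ltnn.
  have P : (v < eend l)%N && Q v (eend l) by rewrite lt Q_sym.
  have le : l = exist _ (v, eend l) P by apply: l0u; right.
  by rewrite {1}le.
have := @Bside_fiber _ _ (l, ord_max) Qc retraction_id (finset.in_setT _)
  (finset.in_setT _).
move=> -> /=; first by congr (~: _)%SET; apply/setP => v; rewrite !inE.
by move=> v _ /uniqv.
Qed.

End Sides.

(** * Weights that determine a cell *)

Section CellWeights.
Variables (R : realType) (W : finType) (S : {set {set W}}).
Hypothesis S_cell : cell R S.

(** A precell contains each proper subset or its complement, and complementary sets have opposite
    weights; so the sign of the weight is never zero and decides membership. *)
Lemma cell_weight : exists w : W -> R, weight w [set: W]%SET = 0 /\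
  forall J, J \in proper_subsets W ->
    weight w J != 0 /\ (J \in S) = (0 < weight w J).
Proof.
case: S_cell => -[[_ _ _] SS'] [w [w0 wS]]; exists w.
have wT : weight w [set: W]%SET = 0.
  by rewrite -w0 /weight; apply: eq_bigl => j; rewrite inE.
split=> // J; rewrite -SS' !inE => /orP[JS|JS'].
  by have wJ := wS J JS; rewrite gt_eqF // JS /weight wJ.
have wJ : weight w J < 0.
  have := wS _ JS'; rewrite -/(weight w _) -finset.setTD => wcJ.
  have := weightD w (finset.subsetT J); rewrite wT => /esym/eqP.
  by rewrite addr_eq0 => /eqP ->; rewrite oppr_lt0.
rewrite lt_eqF // (lt_gtF wJ); split=> //; apply/negbTE.
by apply: contraTN wJ => /wS wJ; rewrite -leNgt ltW.
Qed.

End CellWeights.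

(** * Initial unions of a sequence and partial sums of weights *)

Section SequencesOver.
Variables (R : realDomainType) (W : finType).
Implicit Types (V U : {set W}) (J : seq {set W}) (w : W -> R).

Lemma opart_cat V J1 J2 : opart V (J1 ++ J2) ->
  (\bigcup_(B <- J1) B \subset V)%SET /\
  opart (V :\: \bigcup_(B <- J1) B)%SET J2.
Proof.
elim: J1 V => [|B J1 IH] V /=.
  by rewrite big_nil finset.sub0set finset.setD0.
move=> /and3P[_ BV /IH[sub oJ2]]; rewrite big_cons finset.subUset BV /=.
rewrite (fintype.subset_trans sub (subsetDl _ _)); split=> //.
by rewrite -finset.setDDl.
Qed.

Lemma take_proper J r : opart [set: W]%SET J -> (0 < r < size J)%N ->
  (\bigcup_(B <- take r J) B)%SET \in proper_subsets W.
Proof.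
move=> oJ /andP[r0 rJ]; have := oJ; rewrite -{1}(cat_take_drop r J).
move=> /opart_cat[_ odrop].
rewrite inE; apply/andP; split.
  case: J r r0 rJ oJ {odrop} => [//|B J] [//|r] _ _ /= /and3P[B0 _ _].
  rewrite big_cons; apply: contraNneq B0 => e.
  by rewrite -finset.subset0 -e finset.subsetUl.
apply: contraTneq odrop => ->; rewrite finset.setDv.
have : (0 < size (drop r J))%N by rewrite size_drop subn_gt0.
case: (drop r J) => [//|B J'] _ /=; rewrite finset.subset0.
by case: (B == finset.set0).
Qed.

(** The set [U] is the union of the blocks already passed; its weight plays the part of [a]. *)
Lemma admissibleP w V U J : opart V J -> (U :&: V)%SET = finset.set0 ->
  admissible w (weight w U) J <->
  forall r, (r < size J)%N ->
    weight w (U :|: \bigcup_(B <- take r.+1 J) B)%SET <= 0.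
Proof.
elim: J V U => [//|B J IH] V U /= /and3P[_ BV oJ] dUV.
have {}dUV v : v \in U -> v \in V -> False.
  by move=> vU vV; move/setP/(_ v): dUV; rewrite !inE vU vV.
have dUB : (U :&: B)%SET = finset.set0.
  apply/setP => v; rewrite !inE; apply/negP => /andP[vU vB].
  exact: (dUV v vU (fintype.subsetP BV v vB)).
have wUB : weight w U + weight w B = weight w (U :|: B)%SET.
  rewrite [RHS](weightD w (finset.subsetUl U B)); congr (_ + weight w _).
  rewrite finset.setDUl finset.setDv finset.set0U.
  by apply/esym/finset.setDidPl; rewrite -finset.setI_eq0 finset.setIC dUB.
have dUB' : ((U :|: B) :&: (V :\: B))%SET = finset.set0.
  apply/setP => v; rewrite !inE; apply/negP => /andP[/orP[vU|->] /andP[_ vV]] //.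
  exact: (dUV v vU vV).
rewrite wUB; split.
  move=> /andP[le /(IH _ _ oJ dUB') adm] [|r] rJ.
    by rewrite big_cons take0 big_nil finset.setU0.
  by rewrite big_cons finset.setUA; exact: adm.
move=> adm; apply/andP; split.
  by have := adm 0%N isT; rewrite big_cons take0 big_nil finset.setU0.
apply/(IH _ _ oJ dUB') => r rJ.
by have := adm r.+1 rJ; rewrite big_cons finset.setUA.
Qed.

Lemma sequences_over_admissible (S : {set {set W}}) w nu (J : nu.-tuple {set W}) :
  weight w [set: W]%SET = 0 ->
  (forall A, A \in proper_subsets W ->
     weight w A != 0 /\ (A \in S) = (0 < weight w A)) ->
  (J \in sequences_over (opposite S) nu) =
  opart [set: W]%SET J && admissible w 0 J.
Proof.
move=> wT wS; rewrite inE -opart_proper_sequence.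
case oJ : (opart _ _) => //=.
have opp A : A \in proper_subsets W -> (A \in opposite S) = (weight w A <= 0).
  move=> pA; have pcA : (~: A)%SET \in proper_subsets W.
    move: pA; rewrite !inE => /andP[A0 AT]; apply/andP; split.
      by apply: contraNneq AT => e; rewrite -(finset.setCK A) e finset.setC0.
    by apply: contraNneq A0 => e; rewrite -(finset.setCK A) e finset.setCT.
  rewrite inE (wS _ pcA).2 le_eqVlt (negbTE (wS _ pA).1) /=.
  have := weightD w (finset.subsetT A); rewrite wT finset.setTD => /esym/eqP.
  by rewrite addrC addr_eq0 => /eqP ->; rewrite oppr_gt0.
have admP := admissibleP w oJ (U := finset.set0).
rewrite {1}/weight finset.big_set0 in admP.
have {}admP := admP (finset.set0I _).
apply/forallP/idP => [H|/admP adm r].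
  apply/admP => r rJ; rewrite finset.set0U.
  (* [sequences_over] imposes nothing on the full union, whereas [admissible] tests it too; its
     weight is the total, zero. *)
  have [rS|rS] := ltnP r.+1 (size J); last first.
    rewrite take_oversize //.
    move: oJ; rewrite opart_proper_sequence => /and3P[_ _ /eqP ->].
    by rewrite wT.
  rewrite -opp; last exact: take_proper.
  have rn : (r.+1 < nu)%N by rewrite -(size_tuple J).
  by have := H (Ordinal rn).
apply/implyP => r0; rewrite opp; last first.
  by apply: take_proper => //; rewrite r0 size_tuple ltn_ord.
have := adm r.-1; rewrite finset.set0U prednK // size_tuple; apply.

exact: ltnW (ltn_ord r).
Qed.

End SequencesOver.

(** * The retarded function as a single signed sum over ordered partitions *)

Section Retarded.
Variables (R : realType) (n : nat) (T : Type) (S : {set {set 'I_n}}) (w : 'I_n -> R).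
Hypothesis wT : weight w [set: 'I_n]%SET = 0.
Hypothesis wS : forall A, A \in proper_subsets 'I_n ->
  weight w A != 0 /\ (A \in S) = (0 < weight w A).

(** An admissible ordered partition occurs for exactly one [nu], its length, which lies between 1
    and [n]; the double sum collapses. *)
Lemma retardedE (L : seq (seq {set 'I_n})) (tJ : seq {set 'I_n} -> functional R T) :
  (0 < n)%N -> uniq L -> (forall J, (J \in L) = opart [set: 'I_n]%SET J) ->
  retarded S tJ = fun g => \sum_(J <- L) - term _ w 0 J * tJ J g.
Proof.
move=> n0 uL LP; apply/funext => g; rewrite /retarded.
pose adm J := admissible w 0 J.
have inner nu : \sum_(J in sequences_over (opposite S) nu) tJ J g =
    \sum_(J <- L | adm J && (size J == nu)) tJ J g.
  rewrite -big_enum -[RHS]big_filter /= -(big_map val xpredT (fun J => tJ J g)).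
  apply: perm_big; apply: uniq_perm.
  - by rewrite (map_inj_uniq val_inj) enum_uniq.
  - exact: filter_uniq.
  move=> J; rewrite mem_filter LP; apply/mapP/idP => [[J' + ->]|].
    by rewrite mem_enum (sequences_over_admissible _ wT wS) /adm size_tuple eqxx
      => /andP[-> ->].
  move=> /andP[/andP[aJ sJ] oJ]; exists (Tuple sJ) => //.
  by rewrite mem_enum (sequences_over_admissible _ wT wS) oJ.
under eq_bigr => nu _ do rewrite inner big_distrr /= big_mkcond /=.
rewrite exchange_big /=; apply: eq_big_seq => J; rewrite LP => oJ.
have J0 : (0 < size J)%N.
  case: J oJ => //= /eqP/setP/(_ (Ordinal n0)); by rewrite !inE.
have Jn : (size J < n.+1)%N.
  by rewrite ltnS; have := opart_size oJ; rewrite finset.cardsT card_ord.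
rewrite /term -/(adm J); case: (adm J) => /=; last first.
  by rewrite mulr0 oppr0 mul0r big1_eq.
rewrite -big_mkcond /= (eq_bigl (fun nu => nu == size J)); last first.
  by move=> nu; rewrite eq_sym.
rewrite big_nat1_eq J0 Jn mulr1; congr (_ * _).
by rewrite -[in RHS](prednK J0) exprS mulN1r opprK.
Qed.

End Retarded.

(** * Retarded two-point factors and the signs of merged weights *)

Section Retarded_tree.
Variables (R : realType) (d : nat) (M : manifold R d) (mu : density M).
Variables (n : nat) (Q : rel 'I_n) (t wp wm : line Q -> two_point M).
Variables (S : {set {set 'I_n}}) (w : 'I_n -> R).
Hypothesis wT : weight w [set: 'I_n]%SET = 0.
Hypothesis wS : forall A, A \in proper_subsets 'I_n ->
  weight w A != 0 /\ (A \in S) = (0 < weight w A).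
Hypothesis Q_sym : symmetric Q.
Hypothesis Q_conn : forall u v, connect Q u v.

Definition retarded_factor (l : line Q) : two_point M :=
  if Bside l \in S then r_bUe (t l) (wp l) (wm l) else r_bDe (t l) (wp l) (wm l).

(** The merged weight of the leaf is the weight of its side of the line, so its sign tells which of
    the two complementary sides lies in [S]. *)
Lemma pruning_compatible k0 V O pi (w' : 'I_n -> R) : pruning k0 V O ->
  retraction Q V pi -> (forall v, v \in V -> w' v = weight w (fiber pi v)) ->
  compatible t wp wm retarded_factor w' O.
Proof.
elim: O V pi w' => [//|s O IH] V pi w' /= [pV kV kp prO] rV w'E.
have BE := Bside_fiber Q_sym Q_conn rV kV pV kp.
have [piV _ _] := rV; have sk := leaf_stem s.
set K := fiber pi (leaf s) in BE.
have kK : leaf s \in K by rewrite inE piV.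
have pK : stem s \notin K by rewrite inE piV // eq_sym.
have pS : K \in proper_subsets 'I_n.
  rewrite inE; apply/andP; split; first by apply/finset.set0Pn; exists (leaf s).
  by apply: contraNneq pK => ->; rewrite inE.
have pcS : (~: K)%SET \in proper_subsets 'I_n.
  rewrite inE; apply/andP; split.
    by apply/finset.set0Pn; exists (stem s); rewrite inE.
  apply: contraTneq kK => KT.
  by have := finset.in_setT (leaf s); rewrite -KT inE.
have wk : w' (leaf s) = weight w K by exact: w'E.
have wc : weight w (~: K)%SET = - weight w K.
  have := weightD w (finset.subsetT K); rewrite wT finset.setTD => /esym/eqP.
  by rewrite addrC addr_eq0 => /eqP.
have [wK0 KS] := wS pS; have [_ cKS] := wS pcS.
rewrite wk; split=> //.
(* If the leaf is [eend], then [Bside] is the complement of the fiber, with opposite weight, while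
   [leaf_first] changes from [wp] to [wm]; the two reversals match. *)
- move=> wKneg; rewrite /retarded_factor BE /leaf_first; case: (s.2 == ord0).
    by rewrite KS (lt_gtF wKneg).
  by rewrite cKS wc oppr_gt0 wKneg.
- move=> wKpos; rewrite /retarded_factor BE /leaf_last; case: (s.2 == ord0).
    by rewrite KS wKpos.
  by rewrite cKS wc oppr_gt0 (lt_gtF wKpos).
- apply: (IH _ _ _ prO (retraction_prune Q_sym rV kV pV kp)) => v.
  rewrite in_setD1 => /andP[vk vV]; rewrite /merge.
  case: eqP => [->|/eqP vp].
    have -> : fiber (fun v => if pi v == leaf s then stem s else pi v) (stem s)
        = (fiber pi (stem s) :|: K)%SET.
      apply/setP => u; rewrite !inE; case: (pi u == leaf s); rewrite ?eqxx ?orbT //.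
      by rewrite orbF.
    rewrite w'E // w'E // [RHS](weightD _ (finset.subsetUl _ K)).
    congr (_ + weight w _); apply/setP => u; rewrite !inE.
    by case: eqP => [->|_]; rewrite ?sk ?orbT ?orbF ?andbF //; case: eqP.
  rewrite w'E //; congr (weight w _); apply/setP => u; rewrite !inE.
  case: (eqVneq (pi u) (leaf s)) => [->|//].
  by rewrite !(eq_sym _ v) (negbTE vk) (negbTE vp).
Qed.

End Retarded_tree.

(** * Factorization of the retarded function of the tree *)

Theorem lemma4p1 (R : realType) (d : nat) (M : manifold R d) (mu : density M)
    (le : M -> M -> Prop)
    (le_closed : closed [set p : M * M | le p.1 p.2])
    (le_refl : forall x, le x x)
    (n : nat) (n_ge2 : (2 <= n)%N) (Q : rel 'I_n) (Q_tree : tree Q)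
    (t wp wm : line Q -> two_point M)
    (tw : forall l, line_functions mu le (t l) (wp l) (wm l))
    (S : {set {set 'I_n}}) (S_cell : cell R S)
    (tJ : seq {set 'I_n} -> functional R 'rV[M]_n)
    (tJ_product : forall J, proper_sequence J ->
       tree_product mu (ordered_factor t wp wm J) (tJ J)) :
  exists r : line Q -> two_point M,
    [/\ forall l, r l = r_bUe (t l) (wp l) (wm l) \/
                  r l = r_bDe (t l) (wp l) (wm l),
        forall l, extremity Q (eend l) ->
          ([set eend l]%SET \in S -> r l = r_eUb (t l) (wp l) (wm l)) /\
          ([set eend l]%SET \in opposite S -> r l = r_eDb (t l) (wp l) (wm l)),
        forall l,
          (Bside l \in S -> r l = r_bUe (t l) (wp l) (wm l)) /\
          (Bside l \in opposite S -> r l = r_bDe (t l) (wp l) (wm l))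
      & tree_product mu r (retarded S tJ)].
Proof.
have [Q_sym Q_irr Q_conn _] := Q_tree.
have [w [wT wS]] := cell_weight S_cell.
have SN A : A \in S -> (~: A)%SET \notin S.
  case: S_cell => _ [v [v0 vS]] AS; apply/negP => /vS vcA; have vA := vS A AS.
  have : weight v [set: 'I_n]%SET = 0.
    by rewrite -v0 /weight; apply: eq_bigl => j; rewrite inE.
  rewrite (weightD v (finset.subsetT A)) finset.setTD => /eqP.
  by rewrite gt_eqF // addr_gt0.
have oppN A : A \in opposite S -> A \notin S.
  by rewrite inE => /SN; rewrite finset.setCK.
have reg_t l : partially_regular mu (t l) by have [[[]]] := tw l.
have reg_wp l : partially_regular mu (wp l) by have [[_ [[]]]] := tw l.
have reg_wm l : partially_regular mu (wm l) by have [[_ [_ []]]] := tw l.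
pose r := retarded_factor t wp wm S.
have rB l : (Bside l \in S -> r l = r_bUe (t l) (wp l) (wm l)) /\
    (Bside l \in opposite S -> r l = r_bDe (t l) (wp l) (wm l)).
  rewrite /r /retarded_factor; split=> [->//|/oppN /negbTE -> //].
have n0 : (0 < n)%N by exact: ltnW.
exists r; split => //.
- by move=> l; rewrite /r /retarded_factor; case: ifP; [left|right].
(* Here [Bside l] is the complement of the singleton, which exchanges the two cells, while [r_eUb]
   and [r_eDb] are [r_bDe] and [r_bUe]. *)
- move=> l /(Bside_extremity Q_sym Q_irr Q_conn) BE.
  have [rS rS'] := rB l; split=> eS.
    by apply: rS'; rewrite BE inE finset.setCK.
  by apply: rS; move: eS; rewrite BE inE.
have pT : proper_sequence [:: [set: 'I_n]%SET].
  rewrite -opart_proper_sequence /= finset.setDv finset.subsetT eqxx !andbT.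
  by apply/finset.set0Pn; exists (Ordinal n0); rewrite inE.
have regF J l : partially_regular mu (ordered_factor t wp wm J l).
  exact: reg_factor.
have reg_r l : partially_regular mu (r l).
  rewrite /r /retarded_factor; case: ifP => _; exact: partially_regularB.
(* A pruning is read off from a derivation of [tree_value], here the one for the sequence with a
   single block, evaluated on zero test functions. *)
have [k0 [ O prO]] : exists k0 O, pruning (Q := Q) k0 [set: 'I_n]%SET O.
  have [_ _ tv] := tJ_product _ pT.
  have /tv/(_ (tJ [:: [set: 'I_n]%SET] (tensor (fun=> fun=> 0)))) :
      forall v : 'I_n, test (@atlas R d M) (fun=> 0) by move=> _; exact: test0.
  by case=> _ /(_ erefl) /tree_value_pruning.
pose L := orderings k0 O.
have LP J : (J \in L) = opart [set: 'I_n]%SET J by exact: orderingsP.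
have LJ J : J \in L -> tree_product mu (ordered_factor t wp wm J) (tJ J).
  by rewrite LP opart_proper_sequence; exact: tJ_product.
have rE := retardedE wT wS tJ n0 (orderings_uniq prO) LP.
rewrite rE; split.
- by apply: distribution_sum => J /LJ[].
- by apply: partially_regular_sum => J /LJ[].
move=> f tf z.
(* The pruning is arbitrary because each derivation of [tree_value] brings its own; the sum on the
   right does not depend on it, so all prunings give the same value. *)
have value k1 O1 : pruning (Q := Q) k1 [set: 'I_n]%SET O1 ->
    pruned_value mu r k1 O1 f = \sum_(J <- L) - term _ w 0 J * tJ J (tensor f).
  move=> prO1.
  have cO1 : compatible t wp wm r w O1.
    apply: (pruning_compatible t wp wm wT wS Q_sym Q_conn prO1 (retraction_id _)).
    by move=> v _; rewrite -weight1; congr (weight w _); apply/setP => u; rewrite !inE.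
  rewrite -[LHS]opprK -(tree_identity reg_t reg_wp reg_wm prO1 cO1 wT tf).
  rewrite -sumrN (perm_big L) /=; last first.
    apply: uniq_perm; [exact: orderings_uniq prO1|exact: orderings_uniq prO|].
    by move=> J; rewrite LP (orderingsP _ prO1).
  apply: eq_big_seq => J /LJ[_ _ /(_ f tf) tv]; rewrite mulNr; congr (- (_ * _)).
  by apply/tv; exact: pruned_value_tree_value.
split.
  move=> /(tree_value_pruned_value reg_r tf)[k1 [ O1 [prO1 ->]]].
  exact: value.
move=> ->; rewrite -(value k0 O prO).
exact: pruned_value_tree_value.
Qed.
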